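(* Let $F$ be a cumulative distribution function of a probability distribution supported on $\mathcal{S}$, twice continuously differentiable on $\mathcal{S}$, and let $\boldsymbol{X}_1,\boldsymbol{X}_2,\dots$ be i.i.d. with c.d.f. $F$. Let $\boldsymbol{x}\in\mathrm{Int}(\mathcal{S})$ be such that $0<F(\boldsymbol{x})<1$. Then $$n^{1/2}\big(F_{n,m}^{\star}(\boldsymbol{x}) - F_m^{\star}(\boldsymbol{x})\big)\xrightarrow{\ \mathscr{D}\ }\mathcal{N}(0,\sigma^2(\boldsymbol{x})),\quad\text{as } m,n\to\infty.$$ Moreover, as $m,n\to\infty$, $n^{1/2}(F_{n,m}^{\star}(\boldsymbol{x})-F(\boldsymbol{x}))\xrightarrow{\mathscr{D}}\mathcal{N}(0,\sigma^2(\boldsymbol{x}))$ if $n^{1/2}m^{-1}\to0$, and $n^{1/2}(F_{n,m}^{\star}(\boldsymbol{x})-F(\boldsymbol{x}))\xrightarrow{\mathscr{D}}\mathcal{N}(\lambda B(\boldsymbol{x}),\sigma^2(\boldsymbol{x}))$ if $n^{1/2}m^{-1}\to\lambda$ for a constant $\lambda>0$.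
   Context: Let $d\ge1$, $\|\boldsymbol{x}\|_1=\sum_i|x_i|$, $\mathcal{S}:=\{\boldsymbol{x}\in[0,1]^d:\|\boldsymbol{x}\|_1\le1\}$, $\mathrm{Int}(\mathcal{S}):=\{\boldsymbol{x}\in(0,1)^d:\|\boldsymbol{x}\|_1<1\}$. For $\boldsymbol{k}\in\mathbb{N}_0^d$ with $\|\boldsymbol{k}\|_1\le m$ (written $\boldsymbol{k}\in\mathbb{N}_0^d\cap m\mathcal{S}$), $P_{\boldsymbol{k},m}(\boldsymbol{x}) := \frac{m!}{(m-\|\boldsymbol{k}\|_1)!\prod_i k_i!}(1-\|\boldsymbol{x}\|_1)^{m-\|\boldsymbol{k}\|_1}\prod_i x_i^{k_i}$. $F_m^{\star}(\boldsymbol{x}) := \sum_{\boldsymbol{k}\in\mathbb{N}_0^d\cap m\mathcal{S}}F(\boldsymbol{k}/m)P_{\boldsymbol{k},m}(\boldsymbol{x})$; $F_n(\boldsymbol{x}) := n^{-1}\sum_{i=1}^n\mathbf{1}\{\boldsymbol{X}_i\le\boldsymbol{x}\}$ (componentwise); $F_{n,m}^{\star}(\boldsymbol{x}) := \sum_{\boldsymbol{k}\in\mathbb{N}_0^d\cap m\mathcal{S}}F_n(\boldsymbol{k}/m)P_{\boldsymbol{k},m}(\boldsymbol{x})$. Here $\sigma^2(\boldsymbol{x}) := F(\boldsymbol{x})(1-F(\boldsymbol{x}))$ and $B(\boldsymbol{x}) := \frac12\sum_{i,j=1}^d(x_i\mathbf{1}_{\{i=j\}}-x_ix_j)\frac{\partial^2}{\partial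 x_i\partial x_j}F(\boldsymbol{x})$. Throughout $m=m(n)$. *)

(* Defs.v *)
From HB Require Import structures.
From mathcomp Require Import all_boot all_order all_algebra.
From mathcomp Require Import all_classical all_reals all_analysis.
Set Implicit Arguments. Unset Strict Implicit. Unset Printing Implicit Defensive.
Import Order.TTheory GRing.Theory Num.Theory Num.Def.
Import numFieldNormedType.Exports.
Local Open Scope classical_set_scope.
Local Open Scope ring_scope.

Section defs.
Context {R : realType} {d : nat}.

Definition vle (x y : 'rV[R]_d) : bool := [forall i, x 0 i <= y 0 i].

Definition simplexS : set 'rV[R]_d :=
  [set x | (forall i, 0 <= x 0 i <= 1) /\ \sum_i x 0 i <= 1].
Definition simplex_int : set 'rV[R]_d :=
  [set x | (forall i, 0 < x 0 i < 1) /\ \sum_i x 0 i < 1].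

Definition ev (i : 'I_d) : 'rV[R]_d := delta_mx 0 i.

(* F is twice continuously differentiable on S: first and second partial
   derivatives exist on Int(S), and F and these partial derivatives are
   continuous on S (the partials extending continuously from Int(S) to S). *)
Definition C2_on_simplex (F : 'rV[R]_d -> R) : Prop :=
  {within simplexS, continuous F} /\
  (forall i, exists g : 'rV[R]_d -> R, {within simplexS, continuous g} /\
     forall y, simplex_int y -> derivable F y (ev i) /\ 'D_(ev i) F y = g y) /\
  (forall i j, exists g : 'rV[R]_d -> R, {within simplexS, continuous g} /\
     forall y, simplex_int y ->
       derivable ('D_(ev i) F) y (ev j) /\ 'D_(ev j) ('D_(ev i) F) y = g y).

(* multi-indices k in N_0^d with |k|_1 <= m are encoded as finite functions
   'I_d -> 'I_(m+1) with sum <= m *)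
Definition mi_norm {m : nat} (k : {ffun 'I_d -> 'I_m.+1}) : nat :=
  (\sum_i (k i : nat))%N.

Definition mi_point {m : nat} (k : {ffun 'I_d -> 'I_m.+1}) : 'rV[R]_d :=
  \row_i ((k i : nat)%:R / m%:R).

Definition bern_weight (m : nat) (k : {ffun 'I_d -> 'I_m.+1}) (x : 'rV[R]_d) : R :=
  (m`!)%:R / (((m - mi_norm k)`! * \prod_i (k i : nat)`!)%N)%:R
  * (1 - \sum_i x 0 i) ^+ (m - mi_norm k) * \prod_i (x 0 i) ^+ (k i : nat).

Definition bernstein (m : nat) (G : 'rV[R]_d -> R) (x : 'rV[R]_d) : R :=
  \sum_(k : {ffun 'I_d -> 'I_m.+1} | (mi_norm k <= m)%N)
     G (mi_point k) * bern_weight k x.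

(* empirical c.d.f. F_n of X_1, ..., X_n (here indexed X 0, ..., X (n-1)) *)
Definition emp_cdf {T : Type} (X : nat -> T -> 'rV[R]_d) (n : nat) (w : T)
  (y : 'rV[R]_d) : R :=
  n%:R^-1 * \sum_(i < n) (if vle (X i w) y then 1 else 0).

Definition sigma2 (F : 'rV[R]_d -> R) (x : 'rV[R]_d) : R := F x * (1 - F x).
Definition biasB (F : 'rV[R]_d -> R) (x : 'rV[R]_d) : R :=
  2^-1 * \sum_i \sum_j ((if i == j then x 0 i else 0) - x 0 i * x 0 j)
                        * 'D_(ev j) ('D_(ev i) F) x.
End defs.

(* convergence in distribution of real random variables Y n to a probability
   law mu on R: the c.d.f.s converge at every continuity point of the
   c.d.f. of mu (i.e. every t with mu {t} = 0) *)
Definition cvg_in_law {R : realType} {dm : measure_display} {T : measurableType dm}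
  (P : probability T R) (Y : nat -> T -> R) (mu : set R -> \bar R) : Prop :=
  forall t : R, mu [set t] = 0%E ->
    (fun n => fine (P [set w | Y n w <= t])) @ \oo --> fine (mu [set u | u <= t]).

(* Main.v *)
(** Write [P_k] for the Bernstein weights at [x] and [p = F x].  Since the [P_k]
    sum to 1,
      n^(1/2) (F*_(n,m)(x) - F*_m(x)) = n^(1/2) (F_n(x) - F(x)) + V_n,
    where [V_n] averages [U(y) = n^(1/2) ((F_n - F)(y) - (F_n - F)(x))] over
    [y = k/m].  By Jensen, [E V_n^2] is at most the Bernstein polynomial of
    [y |-> E U(y)^2], and [E U(y)^2] is at most the probability that [X_1 <= x]
    and [X_1 <= y] disagree, a function which vanishes continuously at [x];
    hence [V_n -> 0] in probability.  The main term is a normalised binomial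
    variable, so only the de Moivre-Laplace theorem is needed.  The bias
    [F*_m(x) - F(x) = B(x)/m + o(1/m)] follows from Taylor's formula and the
    second and fourth moments of the multinomial law, and Slutsky's lemma
    concludes.

    De Moivre-Laplace is proved by Stein's method with compactly supported test
    functions: if [g] is Lipschitz with compact support and [E g(N) = 0] for
    [N] normal with variance [s^2 = p (1 - p)], then the solution [f] of
    [s^2 f'(u) - u f(u) = s^2 g(u)] also has compact support, and the binomial
    identity [E (S_n - n p) g(S_n) = n p q E (g(S_(n-1) + 1) - g(S_(n-1)))]
    gives [E g(W_n) = O(n^(-1/2))].  The normalisation of [E g(N)] is removed by
    comparing [g] with a plateau function whose mean is close to 1 under both
    laws. *)

Require Import Defs.
From HB Require Import structures.
From mathcomp Require Import all_boot all_order all_algebra.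
From mathcomp Require Import all_classical all_reals all_analysis.
From mathcomp Require Import measurable_realfun.
From mathcomp Require Import ring lra.
Set Implicit Arguments.
Unset Strict Implicit.
Unset Printing Implicit Defensive.
Import Order.TTheory GRing.Theory Num.Theory Num.Def.
Import numFieldNormedType.Exports.
Local Open Scope classical_set_scope.
Local Open Scope ring_scope.

(** * Expectations under i.i.d. sampling from a finite alphabet *)

(* The expectation of [H(a_1, ..., a_m)] for i.i.d. letters [a_i] of law [w].
   Bernstein polynomials are the case of [d + 1] letters, where [Some i] has
   weight [x_i] and [None] has weight [1 - |x|_1]; binomial laws are the case
   of two letters. *)
Fixpoint iidE {R : realType} {J : finType} (w : J -> R) (m : nat)
    (H : seq J -> R) : R :=
  if m is m'.+1 then \sum_a w a * iidE w m' (fun s => H (a :: s)) else H [::].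

Section iidE.
Context {R : realType} {J : finType}.
Variable w : J -> R.

Lemma eq_iidE m (H H' : seq J -> R) :
  (forall s, size s = m -> H s = H' s) -> iidE w m H = iidE w m H'.
Proof.
elim: m H H' => [|m IH] H H' HH /=; first exact: HH.
by apply: eq_bigr => a _; congr (_ * _); apply: IH => s ss; apply: HH; rewrite /= ss.
Qed.

Lemma iidE_sum m (I : Type) (r : seq I) (Q : pred I) (H : I -> seq J -> R) :
  iidE w m (fun s => \sum_(i <- r | Q i) H i s) = \sum_(i <- r | Q i) iidE w m (H i).
Proof.
elim: m H => [|m IH] H //=.
rewrite exchange_big; apply: eq_bigr => a _.
by rewrite IH mulr_sumr.
Qed.

Lemma iidEZ m (c : R) (H : seq J -> R) :
  iidE w m (fun s => c * H s) = c * iidE w m H.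
Proof.
elim: m H => [|m IH] H //=; rewrite mulr_sumr; apply: eq_bigr => a _.
by rewrite IH mulrCA.
Qed.

Lemma iidED m (H H' : seq J -> R) :
  iidE w m (fun s => H s + H' s) = iidE w m H + iidE w m H'.
Proof.
elim: m H H' => [|m IH] H H' //=; rewrite -big_split; apply: eq_bigr => a _ /=.
by rewrite IH mulrDr.
Qed.

(** Induction on [m] through the first letter: drawing [a] leaves [k] lowered by one at [a] for the
    remaining letters, and the resulting terms recombine because the [k a] add up to the length of
    the word. *)
Lemma iidE_multinomial m (k : J -> nat) : (\sum_j k j = m)%N ->
  iidE w m (fun s => [forall j, count_mem j s == k j]%:R) =
  m`!%:R / (\prod_j (k j)`!)%N%:R * \prod_j w j ^+ k j.
Proof.
have F0 (h : J -> nat) : (\prod_j (h j)`!)%N%:R != 0 :> R.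
  by rewrite pnatr_eq0 -lt0n prodn_gt0// => j; exact: fact_gt0.
elim: m k => [|m IH] k km /=.
  have k0 j : k j = 0%N.
    by apply/eqP; rewrite -leqn0 -km (bigD1 j)//= leq_addr.
  rewrite !big1 ?divr1 ?mulr1//; try by move=> j _; rewrite k0.
  by case: forallP => // -[] j; rewrite k0.
pose k' a j := (k j - (j == a))%N.
(* Words starting with [a] carry the fraction [k a / (m + 1)] of the total mass. *)
transitivity (\sum_a ((k a)%:R * (m`!%:R / (\prod_j (k j)`!)%N%:R * \prod_j w j ^+ k
    j))); last first.
  rewrite -mulr_suml -natr_sum km !mulrA; congr (_ / _ * _).
  by rewrite -natrM factS.
apply: eq_bigr => a _.
(* If [k a = 0], no word starting with [a] has counts [k]; the case is separate because the
   subtraction in [k'] truncates. *)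
have [ka0|ka0] := posnP (k a).
  rewrite ka0 mulr0n mul0r (@eq_iidE _ _ (fun=> 0 * 0)) ?iidEZ ?mul0r ?mulr0// => s _ /=.
  case: forallP => // /(_ a); rewrite /= eqxx ka0 add1n.
  by move=> /eqP.
rewrite (@eq_iidE _ _ (fun s => [forall j, count_mem j s == k' a j]%:R)); last first.
  move=> s _; congr (nat_of_bool _)%:R; apply: eq_forallb => j.
  rewrite /k' /= [j == a]eq_sym; case: (eqVneq a j) => [<-|_];
      last by rewrite /= add0n subn0.
  by rewrite /= add1n subn1 -[in LHS](prednK ka0) eqSS.
have kE j : k j = (k' a j + (j == a))%N.
  by rewrite /k'; case: (eqVneq j a) => [->|_]; rewrite /= ?subn0 ?addn0// subnK.
rewrite IH; last first.
  have s1 : (\sum_j (j == a) = 1)%N.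
    by rewrite (bigD1 a)//= eqxx big1// => j /negbTE ->.
  move: km; rewrite (eq_bigr _ (fun j _ => kE j)) big_split/= s1 addn1.
  by case.
have -> : \prod_j w j ^+ k j = w a * \prod_j w j ^+ k' a j.
  rewrite (bigD1 a)//= [in RHS](bigD1 a)//= mulrA; congr (_ * _).
    by rewrite kE eqxx addn1 exprS.
  by apply: eq_bigr => j ja; rewrite kE (negbTE ja) addn0.
have -> : (\prod_j (k j)`!)%N = (k a * \prod_j (k' a j)`!)%N.
  rewrite (bigD1 a)//= [in RHS](bigD1 a)//= mulnA; congr (_ * _)%N.
    by rewrite [in LHS]kE eqxx addn1 factS; congr (_ * _)%N; rewrite [RHS]kE eqxx addn1.
  by apply: eq_bigr => j ja; rewrite kE (negbTE ja) addn0.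
have ka : (k a)%:R != 0 :> R by rewrite pnatr_eq0 -lt0n.
have := F0 (k' a); move: (\prod_j _)%N => N N0.
by rewrite natrM; field; rewrite ka N0.
Qed.

Hypothesis w1 : \sum_a w a = 1.

Lemma iidE_cst m c : iidE w m (fun=> c) = c.
Proof.
elim: m => //= m IH.
by rewrite -[RHS]mul1r -w1 mulr_suml; apply: eq_bigr => a _; rewrite IH.
Qed.

Lemma iidE1D m (phi : J -> R) :
  iidE w m (fun s => \sum_(a <- s) phi a) = m%:R * \sum_a w a * phi a.
Proof.
elim: m => [|m IH] /=; first by rewrite big_nil mul0r.
rewrite -natr1 mulrDl mul1r -IH -[X in _ = X + _]mul1r -w1 mulr_suml -big_split.
apply: eq_bigr => a _ /=.
rewrite (@eq_iidE _ _ (fun s => phi a + \sum_(b <- s) phi b)); last first.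
  by move=> s _; rewrite big_cons.
by rewrite iidED iidE_cst mulrDr addrC.
Qed.

(** Products of letters at different positions average to zero by centring, so only the [m] diagonal
    terms survive. *)
Lemma iidE_variance m (phi psi : J -> R) :
  \sum_a w a * phi a = 0 -> \sum_a w a * psi a = 0 ->
  iidE w m (fun s => (\sum_(a <- s) phi a) * (\sum_(a <- s) psi a)) =
  m%:R * \sum_a w a * (phi a * psi a).
Proof.
move=> phi0 psi0.
elim: m => [|m IH] /=; first by rewrite !big_nil !mul0r.
rewrite -natr1 mulrDl mul1r -IH -[X in _ = X + _]mul1r -w1 mulr_suml -big_split.
apply: eq_bigr => a _ /=.
rewrite (@eq_iidE _ _ (fun s => phi a * psi a + (phi a * (\sum_(b <- s) psi b) +
   (psi a * (\sum_(b <- s) phi b) +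
     (\sum_(b <- s) phi b) * (\sum_(b <- s) psi b))))); last first.
  by move=> s _; rewrite !big_cons; ring.
by rewrite !iidED !iidEZ !iidE1D iidE_cst phi0 psi0 !mulr0; ring.
Qed.

Hypothesis w0 : forall a, 0 <= w a.

Lemma ler_iidE m (H H' : seq J -> R) :
  (forall s, size s = m -> H s <= H' s) -> iidE w m H <= iidE w m H'.
Proof.
elim: m H H' => [|m IH] H H' HH /=; first exact: HH.
apply: ler_sum => a _; apply: ler_wpM2l => //.
by apply: IH => s ss; apply: HH; rewrite /= ss.
Qed.

Lemma ler_norm_iidE m (H : seq J -> R) :
  `|iidE w m H| <= iidE w m (fun s => `|H s|).
Proof.
elim: m H => [|m IH] H //=; apply: (le_trans (ler_norm_sum _ _ _)).
apply: ler_sum => a _; rewrite normrM (ger0_norm (w0 a)).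
exact: ler_wpM2l.
Qed.

(** One more letter raises the fourth moment by at most [1 + 6 m]: in the binomial expansion the two
    terms of odd degree in the new letter average to zero. The increment of [3 m ^ 2] is larger. *)
Lemma iidE_fourth_moment m (phi : J -> R) :
  \sum_a w a * phi a = 0 -> (forall a, `|phi a| <= 1) ->
  iidE w m (fun s => (\sum_(a <- s) phi a) ^+ 4) <= 3 * m%:R ^+ 2.
Proof.
move=> phi0 phi1.
have sq1 a : phi a ^+ 2 <= 1.
  by rewrite -real_normK ?num_real// expr_le1.
elim: m => [|m IH] /=; first by rewrite big_nil !expr0n mulr0.
have M2 : iidE w m (fun s => (\sum_(b <- s) phi b) ^+ 2) <= m%:R.
  rewrite (@eq_iidE _ _ (fun s => (\sum_(b <- s) phi b) * (\sum_(b <- s) phi b))) =>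
      [|s _]; last exact: expr2.
  rewrite iidE_variance// ler_piMr//.
  rewrite -[leRHS]w1; apply: ler_sum => a _.
  by rewrite ler_piMr// -expr2.
set M3 := iidE w m (fun s => (\sum_(b <- s) phi b) ^+ 3).
set M4 := iidE w m (fun s => (\sum_(b <- s) phi b) ^+ 4) in IH.
(* The term with the third moment is kept apart, since it cancels only after summation over [a]. *)
apply: (@le_trans _ _ (\sum_a (w a * (1 + 6 * m%:R + M4) + 4 * M3 * (w a * phi a)))).
  apply: ler_sum => a _.
  rewrite (@eq_iidE _ _ (fun s => phi a ^+ 4 + (4 * phi a ^+ 3 * (\sum_(b <- s) phi b) +
    (6 * phi a ^+ 2 * (\sum_(b <- s) phi b) ^+ 2 +
    (4 * phi a * (\sum_(b <- s) phi b) ^+ 3 + (\sum_(b <- s) phi b) ^+ 4))))); last first.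
    by move=> s _; rewrite !big_cons; ring.
  rewrite !iidED !iidEZ iidE1D iidE_cst phi0 -/M3 -/M4 !mulr0 add0r.
  set M := iidE _ _ _ in M2 *.
  have -> : 4 * M3 * (w a * phi a) = w a * (4 * phi a * M3) by ring.
  rewrite -mulrDr; apply: ler_wpM2l => //.
  have M0 : 0 <= M.
    rewrite -[leLHS](iidE_cst m 0); apply: ler_iidE => s _; exact: sqr_ge0.
  have q1 : phi a ^+ 4 <= 1.
    by rewrite (exprM _ 2 2) expr_le1 ?sqr_ge0.
  have q2 : phi a ^+ 2 * M <= 1 * m%:R.
    by apply: ler_pM => //; exact: sqr_ge0.
  lra.
rewrite big_split/= -mulr_suml -mulr_sumr w1 phi0 mulr0 addr0 mul1r -natr1.
have : 0 <= m%:R :> R by [].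
nra.
Qed.

End iidE.

(** * Bernstein polynomials as multinomial expectations *)

Lemma big_option (V : Type) (idx : V) (op : Monoid.com_law idx) (I : finType)
    (f : option I -> V) :
  \big[op/idx]_j f j = op (f None) (\big[op/idx]_i f (Some i)).
Proof.
rewrite (bigD1 None)//=; congr (op _ _).
rewrite (reindex_omap Some id)//=; last by case.
by apply: eq_bigl => i; rewrite eqxx.
Qed.

Section bernstein_iid.
Context {R : realType} {d : nat}.
Implicit Types (x : 'rV[R]_d) (G : 'rV[R]_d -> R).

Definition cat_weight x (j : option 'I_d) : R :=
  if j is Some i then x 0 i else 1 - \sum_i x 0 i.

Definition freq m (s : seq (option 'I_d)) : 'rV[R]_d :=
  \row_i ((count_mem (Some i) s)%:R / m%:R).

Lemma sum_cat_weight x : \sum_j cat_weight x j = 1.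
Proof. by rewrite big_option/= subrK. Qed.

Lemma count_option m (s : seq (option 'I_d)) : size s = m ->
  (count_mem None s + \sum_i count_mem (Some i) s = m)%N.
Proof.
move=> <-; elim: s => [|j s IH] /=; first by rewrite big1.
rewrite big_split/= addnACA IH -addn1 addnC; congr (_ + _)%N.
case: j => [i|] /=; last by rewrite big1.
rewrite (bigD1 i)//= eqxx big1// => j /negbTE ji.
by rewrite (inj_eq Some_inj) eq_sym ji.
Qed.

(** Words of length [m] are grouped by their letter counts: a Bernstein weight is the probability of
    a count vector, in which [None] takes the remaining [m - mi_norm k] places. *)
Lemma bernsteinE m G x :
  bernstein m G x = iidE (cat_weight x) m (fun s => G (freq m s)).
Proof.
have nr (k : {ffun 'I_d -> 'I_m.+1}) : (mi_norm k <= m)%N ->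
    bern_weight k x = iidE (cat_weight x) m
      (fun s => [forall i, count_mem (Some i) s == k i]%:R).
  move=> km; pose kk j := if j is Some i then k i : nat else (m - mi_norm k)%N.
  have skk : (\sum_j kk j = m)%N.
    by rewrite big_option/= subnK.
  rewrite (@eq_iidE _ _ _ _ _ (fun s => [forall j, count_mem j s == kk j]%:R)).
    rewrite (iidE_multinomial _ skk).
    rewrite !big_option/=.
    by rewrite /bern_weight mulrA.
  move=> s sm; congr (nat_of_bool _)%:R; apply/forallP/forallP => [ks|ks i];
      last exact: (ks (Some i)).
  case=> [i|] /=; first exact: ks.
  have := count_option sm; rewrite (eq_bigr (fun i => k i : nat)); last first.
    by move=> i _; apply/eqP; exact: ks.
  by move=> cm; rewrite -(eqn_add2r (mi_norm k)) subnK//; apply/eqP.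
rewrite /bernstein (eq_bigr _ (fun k km => congr1 (fun z => G (mi_point k) * z) (nr k km))).
under eq_bigr do rewrite -iidEZ.
rewrite -iidE_sum; apply: eq_iidE => s sm.
have cm i : (count_mem (Some i) s < m.+1)%N.
  by rewrite ltnS -sm; exact: count_size.
(* Each word has exactly one count vector, so the sum over multi-indices collapses to this term. *)
pose k : {ffun 'I_d -> 'I_m.+1} := [ffun i => Ordinal (cm i)].
have kE i : k i = count_mem (Some i) s :> nat by rewrite ffunE.
rewrite (bigD1 k)/=; last first.
  rewrite /mi_norm -[leqRHS](count_option sm).
  by rewrite (eq_bigr _ (fun i _ => kE i)) leq_addl.
rewrite big1 ?addr0; last first.
  move=> k' /andP[_ kk']; case: forallP => [kc|]; last by rewrite mulr0.
  case/negP: kk'; apply/eqP/ffunP => i; apply/val_inj => /=.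
  by rewrite kE; apply/esym/eqP; exact: kc.
case: forallP => [_|[] i]; last by rewrite kE.
rewrite mulr1; congr G; apply/rowP => i.
by rewrite !mxE kE.
Qed.

End bernstein_iid.

(** * Stein's equation *)

Section real_lipschitz.
Context {R : realType}.
Implicit Types f df g : R -> R.

Lemma is_derive_continuous f df :
  (forall u : R, is_derive u 1 f (df u)) -> continuous f.
Proof.
move=> fdf u; apply: differentiable_continuous.
by apply/derivable1_diffP; have [] := fdf u.
Qed.

(** No order between the endpoints is imposed, because the lemma is applied to signed coordinate
    increments. *)
Lemma MVT_between f df (u v : R) :
  (forall w : R, (u <= w <= v) || (v <= w <= u) -> is_derive w 1 f (df w)) ->
  exists2 c, (u <= c <= v) || (v <= c <= u) & f v - f u = df c * (v - u).
Proof.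
wlog uv : u v / u <= v => [hw|] fdf.
  have [|vu] := leP u v; first by move=> uv; exact: hw.
  have [w|c cv e] := hw v u (ltW vu); first by rewrite orbC; exact: fdf.
  exists c; first by rewrite orbC.
  by rewrite -opprB e -mulrN opprB.
have cf : {within `[u, v], continuous f}.
  apply: derivable_within_continuous => w; rewrite in_itv/= => uwv.
  by have [] := fdf w (introT orP (or_introl uwv)).
have fd (w : R) : w \in `]u, v[ -> is_derive w 1 f (df w).
  rewrite in_itv/= => /andP[uw wv]; apply: fdf.
  by rewrite (ltW uw) (ltW wv).
have [c] := MVT_segment uv fd cf.
by rewrite in_itv/= => ucv e; exists c => //; rewrite ucv.
Qed.

Lemma between_dist (u v c : R) :
  (u <= c <= v) || (v <= c <= u) -> `|c - u| <= `|v - u|.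
Proof.
case/orP => /andP[h1 h2].
  by rewrite !ger0_norm ?subr_ge0// ?(le_trans h1)// lerD2r.
by rewrite !ler0_norm ?subr_le0// ?(le_trans h1)// lerN2 lerD2r.
Qed.

Lemma MVT_dist f df (u v : R) : (forall w : R, is_derive w 1 f (df w)) ->
  exists2 c, `|c - u| <= `|v - u| & f v - f u = df c * (v - u).
Proof.
move=> fdf; have [c /between_dist cuv e] := @MVT_between f df u v (fun w _ => fdf w).
by exists c.
Qed.

Lemma lipschitz_derive_bounded f df (M : R) :
  (forall w : R, is_derive w 1 f (df w)) -> (forall w, `|df w| <= M) ->
  forall u v, `|f v - f u| <= M * `|v - u|.
Proof.
move=> fdf dfM u v; have [c _ ->] := MVT_dist u v fdf.
by rewrite normrM ler_wpM2r.
Qed.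

Lemma continuous_supp_bounded f (A : R) : continuous f ->
  (forall u, A < `|u| -> f u = 0) -> exists M : R, forall u, `|f u| <= M.
Proof.
move=> cf f0.
(* Taking the absolute value keeps the interval nonempty when [A] is negative. *)
have A0 : - `|A| <= `|A| by rewrite ge0_cp.
have cnf : {within `[- `|A|, `|A|], continuous (fun u => `|f u|)}.
  by apply: continuous_subspaceT => u; apply: cvg_norm; exact: cf.
have [c _ fc] := EVT_max A0 cnf; exists `|f c| => u.
have [uA|uA] := leP `|u| `|A|.
  by apply: fc; rewrite in_itv/= -ler_norml.
by rewrite f0 ?normr0//; apply: le_lt_trans uA; exact: ler_norm.
Qed.

Lemma lipschitz_continuous f (L : R) :
  (forall u v, `|f v - f u| <= L * `|v - u|) -> continuous f.
Proof.
move=> fL u; apply/cvgrPdist_le => e e0.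
have L0 : 0 < `|L| + 1 by rewrite ltr_wpDl.
near=> v; apply: le_trans (fL v u) _.
apply: (@le_trans _ _ ((`|L| + 1) * `|u - v|)).
  by rewrite ler_wpM2r// (le_trans (ler_norm L)) ?lerDl.
rewrite -ler_pdivlMl//; near: v.
apply/nbhs_normP; exists ((`|L| + 1)^-1 * e); first by rewrite /= mulr_gt0 ?invr_gt0.
by move=> v /= /ltW.
Unshelve. all: by end_near. Qed.

End real_lipschitz.

Section stein.
Context {R : realType}.
Variable s : R.
Hypothesis s0 : 0 < s.
Local Notation phi := (normal_pdf 0 s).
Local Notation mu := (@lebesgue_measure R).

Lemma normal_pdf_inv (u : R) :
  phi u * expR (u ^+ 2 / (s ^+ 2 *+ 2)) = normal_peak s.
Proof.
rewrite normal_pdfE ?gt_eqF// /normal_fun subr0 mulNr -mulrA -expRD.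
by rewrite addNr expR0 mulr1.
Qed.

Lemma integrable_mul_normal_pdf (g : R -> R) (M : R) (D : set (measurableTypeR R)) :
  measurable D -> continuous g -> (forall u, `|g u| <= M) ->
  mu.-integrable D (EFin \o (fun u => g u * phi u)).
Proof.
move=> mD cg gM; apply: (@integrableS _ _ _ _ setT) => //.
have i1 := integrableZl measurableT (`|M|) (integrable_normal_pdf 0 s).
apply: le_integrable i1 => //.
  apply/measurable_EFinP; apply: measurable_funM.
    exact: continuous_measurable_fun.
  exact: measurable_normal_pdf.
move=> u _ /=; rewrite lee_fin !normrM normr_id ler_wpM2r//.
exact: le_trans (gM u) (ler_norm _).
Qed.

(** The solution is the primitive of [g * phi] from minus infinity, divided by [phi]. Since the full
    integral is zero, it vanishes on both sides of the support of [g], and compact support then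
    yields all the bounds. *)
Lemma stein_solution (g : R -> R) (A L : R) :
  (forall u v, `|g v - g u| <= L * `|v - u|) ->
  (forall u, A < `|u| -> g u = 0) ->
  (\int[mu]_u (g u * phi u) = 0)%R ->
  exists f df : R -> R, exists K : R,
    [/\ forall u : R, is_derive u 1 f (df u),
        forall u v, `|df v - df u| <= K * `|v - u| &
        forall u, s ^+ 2 * df u - u * f u = s ^+ 2 * g u].
Proof.
move=> gL g0 Ig.
have cg := lipschitz_continuous gL.
have [M gM] := continuous_supp_bounded cg g0.
have cphi : continuous phi by apply: continuous_normal_pdf; rewrite gt_eqF.
have ig (D : set (measurableTypeR R)) : measurable D ->
    mu.-integrable D (EFin \o (fun u => g u * phi u)).
  by move=> mD; exact: integrable_mul_normal_pdf gM.
pose G u := (\int[mu]_(t in [set` Interval -oo%O (BRight u)]) (g t * phi t))%R.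
have dG (u : R) : is_derive u 1 G (g u * phi u).
  have uu1 : u < u + 1 by rewrite ltrDl.
  have [] := @continuous_FTC1 _ (fun t => g t * phi t) -oo%O u (u + 1) uu1.
  - exact: ig.
  - exact: ltNyr.
  - by apply: cvgM; [exact: cg|exact: cphi].
  - rewrite -/G => d1; rewrite derive1E => d2.
    exact: (DeriveDef d1 d2).
pose c := (normal_peak s)^-1.
(* [E u * c] is the reciprocal of [phi u], written so that its derivative is immediate. *)
pose E u : R := expR (u ^+ 2 / (s ^+ 2 *+ 2)).
have phiE u : phi u * E u * c = 1.
  by rewrite normal_pdf_inv divff// gt_eqF// normal_peak_gt0// gt_eqF.
have dE (u : R) : is_derive u 1 E (E u * (u / s ^+ 2)).
  have dsq : is_derive u 1 (fun v : R => v ^+ 2 / (s ^+ 2 *+ 2)) (u / s ^+ 2).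
    pose k := (s ^+ 2 *+ 2)^-1.
    have -> : (fun v : R => v ^+ 2 / (s ^+ 2 *+ 2)) = k *: ((@id R) ^+ 2).
      by apply/funext => v; rewrite /GRing.scale/= mulrC.
    apply: is_derive_eq; rewrite /= /k !expr1 /GRing.scale/=.
    by field; rewrite gt_eqF.
  exact: (@is_derive1_comp _ expR _ u _ _ _ dsq).
pose f u := G u * E u * c.
pose df u := g u + u * f u / s ^+ 2.
have dfE (u : R) : is_derive u 1 f (df u).
  have -> : f = c *: (G * E).
    by apply/funext => v; rewrite /f /GRing.scale/= mulrC.
  apply: is_derive_eq; rewrite /df /f /= /GRing.scale/=.
  rewrite -[in RHS](mulr1 (g u)) -(phiE u); field.
  by rewrite gt_eqF.
(* To the right of the support [G] is the full integral, zero by [Ig]; to the left its integrand is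
   zero. *)
have G0 u : A < `|u| -> G u = 0.
  move=> Au; have [u0|u0] := leP 0 u.
    rewrite -Ig /G Rintegral_mkcond; congr Rintegral; apply/funext => v.
    rewrite patchE; case: ifPn => //; rewrite notin_setE/= in_itv/= => /negP.
    rewrite -ltNge => uv; rewrite g0 ?mul0r//; apply: (lt_trans Au).
    by rewrite (ger0_norm u0) (gtr0_norm (le_lt_trans u0 uv)).
  rewrite /G (@eq_Rintegral _ _ _ _ _ (cst 0)).
    by rewrite Rintegral_cst// mul0r.
  move=> v; rewrite inE/= in_itv/= => vu; rewrite g0 ?mul0r//.
  apply: (lt_le_trans Au); rewrite ltr0_norm// ler0_norm ?lerN2//.
  by rewrite (le_trans vu)// ltW.
have cf := is_derive_continuous dfE.
have cuf : continuous (fun u : R => u * f u).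
  by move=> u; apply: cvgM; [exact: cvg_id|exact: cf].
have f0 u : A < `|u| -> f u = 0 by move=> /G0; rewrite /f => ->; rewrite !mul0r.
have cdf : continuous df.
  move=> u; apply: cvgD; first exact: cg.
  by apply: cvgM; [exact: cuf|exact: cvg_cst].
(* As [df] is [g] plus a multiple of [u * f u], a Lipschitz bound for the latter is enough; its
   derivative [dh] is continuous with compact support, hence bounded. *)
pose dh u := f u + u * df u.
have dhE (u : R) : is_derive u 1 (fun v : R => v * f v) (dh u).
  have -> : (fun v : R => v * f v) = (@id R) * f by [].
  apply: is_derive_eq; rewrite /dh /GRing.scale/=; ring.
have cdh : continuous dh.
  move=> u; apply: cvgD; first exact: cf.
  by apply: cvgM; [exact: cvg_id|exact: cdf].
have [K hK] : exists K : R, forall u, `|dh u| <= K.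
  apply: (@continuous_supp_bounded _ _ A) => // u Au.
  by rewrite /dh /df f0// g0//; ring.
have hL := lipschitz_derive_bounded dhE hK.
exists f, df, (L + K / s ^+ 2); split => //.
  move=> u v; rewrite /df opprD addrACA -mulrBl [leRHS]mulrDl.
  apply: (le_trans (ler_normD _ _)); apply: lerD; first exact: gL.
  rewrite normrM [X in _ * X <= _]ger0_norm ?invr_ge0 ?sqr_ge0//.
  by rewrite mulrAC ler_wpM2r// invr_ge0 sqr_ge0.
by move=> u; rewrite /df; field; rewrite gt_eqF.
Qed.

End stein.

(** * The de Moivre-Laplace theorem *)

Section binomial.
Context {R : realType}.
Variable p : R.
Hypothesis p01 : 0 < p < 1.
Local Notation q := (1 - p).
Local Notation mu := (@lebesgue_measure R).

Definition bern_wt (b : bool) : R := if b then p else q.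

Definition binexp (n : nat) (g : nat -> R) : R :=
  iidE bern_wt n (fun s => g (count id s)).

Lemma bern_wt_ge0 b : 0 <= bern_wt b.
Proof. by case/andP: p01 => ? ?; case: b => /=; lra. Qed.

Lemma sum_bern_wt : \sum_b bern_wt b = 1.
Proof. by rewrite big_bool/= addrC subrK. Qed.

Lemma binexp0 g : binexp 0 g = g 0%N. Proof. by []. Qed.

Lemma binexpS n g : binexp n.+1 g = p * binexp n (fun k => g k.+1) + q * binexp n g.
Proof. by rewrite /binexp /= big_bool. Qed.

Lemma eq_binexp n g h : g =1 h -> binexp n g = binexp n h.
Proof. by move=> gh; apply: eq_iidE => s _; exact: gh. Qed.

Lemma binexpD n g h : binexp n (fun k => g k + h k) = binexp n g + binexp n h.
Proof. exact: iidED. Qed.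

Lemma binexpZ n c g : binexp n (fun k => c * g k) = c * binexp n g.
Proof. exact: iidEZ. Qed.

Lemma binexpB n g h : binexp n (fun k => g k - h k) = binexp n g - binexp n h.
Proof.
rewrite (@eq_binexp _ _ (fun k => g k + (-1) * h k)) => [|k]; last by rewrite mulN1r.
by rewrite binexpD binexpZ mulN1r.
Qed.

Lemma binexp_cst n c : binexp n (fun=> c) = c.
Proof. exact/iidE_cst/sum_bern_wt. Qed.

Lemma ler_binexp n g h : (forall k, g k <= h k) -> binexp n g <= binexp n h.
Proof. by move=> gh; apply: ler_iidE => [|s _]; [exact: bern_wt_ge0|exact: gh]. Qed.

Lemma ler_norm_binexp n g (M : R) : (forall k, `|g k| <= M) -> `|binexp n g| <= M.
Proof.
move=> gM; apply: (le_trans (ler_norm_iidE _ _ _)); first exact: bern_wt_ge0.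
rewrite -[leRHS](binexp_cst n); exact: (@ler_binexp n (fun k => `|g k|)).
Qed.

(** Size biasing: by symmetry each of the [n + 1] trials contributes equally to [k], and given that
    one trial succeeds the others form a binomial sample of size [n]. *)
Lemma binexp_success n g :
  binexp n.+1 (fun k => k%:R * g k) = n.+1%:R * p * binexp n (fun k => g k.+1).
Proof.
elim: n g => [|n IH] g; first by rewrite binexpS !binexp0; ring.
rewrite binexpS IH (@eq_binexp _ _ (fun k => g k.+1 + k%:R * g k.+1)); last first.
  by move=> k; rewrite -natr1; ring.
rewrite binexpD (IH (fun k => g k.+1)) binexpS -[n.+2%:R]natr1; ring.
Qed.

Lemma binexp_failure n g :
  binexp n.+1 (fun k => (n.+1%:R - k%:R) * g k) = n.+1%:R * q * binexp n g.
Proof.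
elim: n g => [|n IH] g; first by rewrite binexpS !binexp0; ring.
rewrite binexpS (@eq_binexp _ _ (fun k => (n.+1%:R - k%:R) * g k.+1)); last first.
  by move=> k; rewrite -natr1 -[k.+1%:R]natr1; ring.
rewrite (IH (fun k => g k.+1)) (@eq_binexp n.+1 (fun k => (n.+2%:R - k%:R) * g k)
  (fun k => g k + (n.+1%:R - k%:R) * g k)); last first.
  by move=> k; rewrite -natr1; ring.
rewrite binexpD IH (binexpS n g) -[n.+2%:R]natr1; ring.
Qed.

(** The centred count is [q] times the successes minus [p] times the failures, and each part has its
    own size-biasing identity. *)
Lemma binexp_stein n g :
  binexp n.+1 (fun k => (k%:R - n.+1%:R * p) * g k) =
  n.+1%:R * p * q * binexp n (fun k => g k.+1 - g k).
Proof.
rewrite (@eq_binexp _ _ (fun k => q * (k%:R * g k) - p * ((n.+1%:R - k%:R) * g k)));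
    last first.
  by move=> k; ring.
rewrite binexpB !binexpZ binexp_success binexp_failure binexpB; ring.
Qed.

(** The scale is the square root of [n], not the standard deviation, so the limit law has variance
    [p * q]. At [n = 0] the division returns 0, and the estimates use [n.+1]. *)
Definition bin_std (n k : nat) : R := (k%:R - n%:R * p) / Num.sqrt n%:R.

Lemma binexp_std_sqr n : binexp n.+1 (fun k => bin_std n.+1 k ^+ 2) = p * q.
Proof.
have n0 : (0 : R) < n.+1%:R by [].
rewrite (@eq_binexp _ _ (fun k => n.+1%:R^-1 * ((k%:R - n.+1%:R * p) * (k%:R - n.+1%:R *
    p)))); last first.
  by move=> k; rewrite /bin_std expr_div_n sqr_sqrtr ?ler0n// expr2 mulrC.
rewrite binexpZ binexp_stein (@eq_binexp _ _ (fun=> 1)); last first.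
  by move=> k; rewrite -natr1; ring.
rewrite binexp_cst; field.
by rewrite gt_eqF.
Qed.

(** With [f] solving Stein's equation, [E g(W)] is the difference of [E f'(W)] and
    [E W f(W) / (p q)]. The binomial identity turns the latter into a mean difference quotient of
    [f], which the mean value theorem compares with [f']. *)
Lemma stein_cvg (g : R -> R) (A L : R) :
  (forall u v, `|g v - g u| <= L * `|v - u|) ->
  (forall u, A < `|u| -> g u = 0) ->
  (\int[mu]_u (g u * normal_pdf 0 (Num.sqrt (p * q)) u) = 0)%R ->
  exists K : R, forall n, `|binexp n.+1 (fun k => g (bin_std n.+1 k))| <= K / Num.sqrt
      n.+1%:R.
Proof.
move=> gL g0 Ig.
have pq0 : 0 < p * q by case/andP: p01 => ? ?; rewrite mulr_gt0// subr_gt0.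
have s0 : 0 < Num.sqrt (p * q) by rewrite sqrtr_gt0.
have [f [df [K [fdf dfK fE]]]] := stein_solution s0 gL g0 Ig.
rewrite sqr_sqrtr ?(ltW pq0)// in fE.
(* [E2] and [E3] each cost [K / r]; the factor [1 / (p * q)] is at least 1. *)
exists (2 * K / (p * q)) => n.
set r := Num.sqrt n.+1%:R.
have r0 : 0 < r by rewrite sqrtr_gt0.
have rr : r * r = n.+1%:R by rewrite -expr2 sqr_sqrtr.
have stdS k : bin_std n.+1 k.+1 = bin_std n.+1 k + r^-1.
  by rewrite /bin_std -/r -natr1; field; rewrite gt_eqF.
have K0 : 0 <= K.
  have := dfK 0 1; rewrite subr0 normr1 mulr1; exact: le_trans.
have dr0 : 0 <= r^-1 by rewrite invr_ge0 ltW.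
have step k : `|bin_std n.+1 k.+1 - bin_std n.+1 k| = r^-1.
  by rewrite stdS addrC addKr ger0_norm.
have E1 : binexp n.+1 (fun k => bin_std n.+1 k * f (bin_std n.+1 k)) =
    p * q * (r * binexp n (fun k => f (bin_std n.+1 k.+1) - f (bin_std n.+1 k))).
  rewrite (@eq_binexp _ _ (fun k => r^-1 * ((k%:R - n.+1%:R * p) * f (bin_std n.+1 k))));
      last first.
    by move=> k; rewrite /bin_std -/r; ring.
  rewrite binexpZ binexp_stein -rr; field.
  by rewrite gt_eqF.
have E2 : `|r * binexp n (fun k => f (bin_std n.+1 k.+1) - f (bin_std n.+1 k)) -
           binexp n (fun k => df (bin_std n.+1 k))| <= K / r.
  rewrite -binexpZ -binexpB; apply: ler_norm_binexp => k.
  have [c ck ->] := MVT_dist (bin_std n.+1 k) (bin_std n.+1 k.+1) fdf.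
  rewrite stdS [bin_std n.+1 k + _ - _]addrAC subrr add0r mulrCA mulfV ?gt_eqF// mulr1.
  apply: (le_trans (dfK _ _)); rewrite ler_wpM2l//.
  by apply: (le_trans ck); rewrite step.
(* The binomial identity lowers the sample size by one. Conditioning on one trial shows that
   restoring it moves the mean by at most one step of [df]. *)
have E3 : `|binexp n.+1 (fun k => df (bin_std n.+1 k)) -
           binexp n (fun k => df (bin_std n.+1 k))| <= K / r.
  rewrite binexpS.
  set a := binexp n (fun k => df (bin_std n.+1 k)).
  set b := binexp n _.
  have -> : p * b + (1 - p) * a - a = p * (b - a) by ring.
  case/andP: p01 => p0 p1.
  rewrite normrM gtr0_norm//; apply: (@le_trans _ _ `|b - a|).
    by rewrite ler_piMl// ltW.
  rewrite /b /a -binexpB; apply: ler_norm_binexp => k.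
  by apply: (le_trans (dfK _ _)); rewrite step.
have -> : binexp n.+1 (fun k => g (bin_std n.+1 k)) =
   (p * q)^-1 * (p * q * binexp n.+1 (fun k => df (bin_std n.+1 k)) -
   binexp n.+1 (fun k => bin_std n.+1 k * f (bin_std n.+1 k))).
  rewrite -binexpZ -binexpB -binexpZ; apply: eq_binexp => k.
  by rewrite fE mulKf// gt_eqF.
rewrite E1 -mulrBr mulKf ?gt_eqF//.
set a := binexp n.+1 _ in E3 *; set b := r * _ in E2 *; set c := binexp n _ in E2 E3.
have abK : `|a - b| <= 2 * (K / r).
  have -> : a - b = (a - c) - (b - c) by ring.
  apply: (le_trans (ler_normB _ _)); lra.
apply: (le_trans abK).
have [p0 p1] := andP p01.
have pq1 : 1 <= (p * q)^-1.
  by rewrite -[leLHS]invr1 lef_pV2 ?posrE//; nra.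
rewrite -[leLHS]mulr1 -!mulrA [(p * q)^-1 * _]mulrC !mulrA ler_wpM2l//.
by rewrite !mulr_ge0.
Qed.

End binomial.

(** * Real-valued probabilities, the normal law and plateau test functions *)

Section fine_probability.
Context {R : realType} {dm : measure_display} {T : measurableType dm}.
Variable P : probability T R.

Lemma fine_probability_ge0 A : 0 <= fine (P A).
Proof. exact/fine_ge0/measure_ge0. Qed.

Lemma fine_probability_le A B : measurable A -> measurable B -> A `<=` B ->
  fine (P A) <= fine (P B).
Proof.
move=> mA mB AB; apply: fine_le; try exact: fin_num_measure.
by apply: le_measure; rewrite ?inE.
Qed.

Lemma fine_probabilityU A B : measurable A -> measurable B ->
  fine (P (A `|` B)) <= fine (P A) + fine (P B).
Proof.
move=> mA mB; rewrite -fineD; try exact: fin_num_measure.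
apply: fine_le; [|rewrite fin_numD !fin_num_measure//|exact: measureU2].
by apply: fin_num_measure; exact: measurableU.
Qed.

Lemma fine_probabilityC A : measurable A -> fine (P (~` A)) = 1 - fine (P A).
Proof. by move=> mA; rewrite probability_setC// fineB// fin_num_measure. Qed.

Lemma fine_probability_le1 A : measurable A -> fine (P A) <= 1.
Proof.
move=> mA; have := probability_le1 P mA.
by rewrite -[P A]fineK ?fin_num_measure// lee_fin.
Qed.

End fine_probability.

Section normal.
Context {R : realType}.
Variable s : R.
Hypothesis s0 : 0 < s.
Local Notation phi := (normal_pdf 0 s).
Local Notation mu := (@lebesgue_measure R).
Local Notation nu := (normal_prob 0 s : probability _ R).

Definition normal_cdf (t : R) : R := fine (normal_prob 0 s [set u | u <= t]).

Lemma measurable_le_set (t : R) : measurable ([set u | u <= t] : set (measurableTypeR R)).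
Proof. by rewrite -set_itvNyc; exact: measurable_itv. Qed.

(** The density never exceeds its peak, so the distribution function is Lipschitz; this gives
    explicit constants in all later sandwich arguments. *)
Lemma normal_cdf_le_add (t t' : R) : t <= t' ->
  normal_cdf t' <= normal_cdf t + normal_peak s * (t' - t).
Proof.
move=> tt'; rewrite /normal_cdf.
have -> : [set u | u <= t'] = [set u | u <= t] `|` `]t, t'].
  apply/seteqP; split => u /=; rewrite in_itv/=.
    by move=> ut'; case: (leP u t); [left|right].
  by case=> [/le_trans->//|/andP[]].
apply: (le_trans (fine_probabilityU nu (measurable_le_set t) (measurable_itv _))).
rewrite lerD2l.
have i1 : mu.-integrable `]t, t'] (EFin \o phi).
  apply: (@integrableS _ _ _ _ setT) => //; exact: integrable_normal_pdf.
have i2 : mu.-integrable `]t, t'] (EFin \o cst (normal_peak s)).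
  apply/integrableP; split; first exact/measurable_EFinP.
  rewrite (_ : (fun _ => _) = cst `|normal_peak s|%:E)// integral_cst//=.
  by rewrite lebesgue_measure_itv/=; case: ifP => _; rewrite -?EFinB -?EFinM ?mule0 ltry.
have <- : (\int[mu]_(u in `]t, t']) (cst (normal_peak s)) u)%R = normal_peak s * (t' - t).
  rewrite Rintegral_cst//; congr (_ * _).
  rewrite /= lebesgue_measure_itv/= lte_fin.
  case: ifPn => //=; rewrite -leNgt => t't.
  by apply/esym/eqP; rewrite subr_eq0 eq_le tt' t't.
apply: le_Rintegral => // u _.
by apply: normal_pdf_ub; rewrite gt_eqF.
Qed.

(** The last two hypotheses place [g] below the indicator of [D]; continuity and the bound [M] give
    integrability. *)
Lemma Rintegral_normal_le (g : R -> R) (M : R) (D : set (measurableTypeR R)) : measurable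
    D ->
  continuous g -> (forall u, `|g u| <= M) ->
  (forall u, D u -> g u <= 1) -> (forall u, ~ D u -> g u <= 0) ->
  (\int[mu]_u (g u * phi u))%R <= fine (nu D).
Proof.
move=> mD cg gM g1 g0.
have -> : fine (nu D) = (\int[mu]_(u in D) phi u)%R by [].
have ip := integrable_normal_pdf 0 s.
rewrite [leRHS]Rintegral_mkcond; apply: le_Rintegral => //.
- exact: integrable_mul_normal_pdf gM.
- rewrite (_ : EFin \o _ = (EFin \o phi) \_ D); last by rewrite restrict_EFin.
  have h := integrableS measurableT mD (@subsetT _ D) ip.
  exact: ((integrable_mkcond (fun u : measurableTypeR R => (phi u)%:E) mD).1 h).
move=> u _; rewrite patchE; have := normal_pdf_ge0 0 s u.
case: ifPn => [/set_mem /g1|]; first by move=> ? ?; rewrite ler_piMl.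
by rewrite notin_setE => /g0 ? ?; rewrite mulr_le0_ge0.
Qed.

Lemma Rintegral_normal_ge (g : R -> R) (M : R) (D : set (measurableTypeR R)) : measurable
    D ->
  continuous g -> (forall u, `|g u| <= M) ->
  (forall u, 0 <= g u) -> (forall u, D u -> 1 <= g u) ->
  fine (nu D) <= (\int[mu]_u (g u * phi u))%R.
Proof.
move=> mD cg gM g0 g1.
have -> : fine (nu D) = (\int[mu]_(u in D) phi u)%R by [].
have ip := integrable_normal_pdf 0 s.
rewrite Rintegral_mkcond; apply: le_Rintegral => //.
- rewrite (_ : EFin \o _ = (EFin \o phi) \_ D); last by rewrite restrict_EFin.
  have h := integrableS measurableT mD (@subsetT _ D) ip.
  exact: ((integrable_mkcond (fun u : measurableTypeR R => (phi u)%:E) mD).1 h).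
- exact: integrable_mul_normal_pdf gM.
move=> u _; rewrite patchE; have := normal_pdf_ge0 0 s u.
case: ifPn => [/set_mem /g1|]; first by move=> ? ?; rewrite ler_peMl.
by move=> _ ?; rewrite mulr_ge0.
Qed.

(** Continuity of measure along the intervals from [-n] to [n]. The bound holds for every larger
    [B], so that [B] can meet further constraints later. *)
Lemma normal_tail (e : R) : 0 < e ->
  exists N : nat, forall B : R, N%:R <= B -> 1 - e <= fine (nu `[- B, B]%classic).
Proof.
move=> e0.
pose F (n : nat) : set R := [set` `[- n%:R, n%:R]].
have FT : \bigcup_n F n = setT.
  apply/seteqP; split => // u _; exists (Num.truncn `|u|).+1 => //=.
  by rewrite /F/= in_itv/= -ler_norml ltW// truncnS_gt.
have : nu (F n) @[n --> \oo] --> nu (\bigcup_n F n).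
  apply: nondecreasing_cvg_mu => [n||m n mn]; first exact: measurable_itv.
    by apply: bigcup_measurable => n _; exact: measurable_itv.
  apply/subsetPset => u; rewrite /F/= !in_itv/= -!ler_norml => /le_trans; apply.
  by rewrite ler_nat.
rewrite FT probability_setT => /fine_cvgP[_ /= /cvgrPdist_le /(_ _ e0)[N _ HN]].
exists N => B NB.
have := HN N (leqnn N) => /=; rewrite ler_distlC => /andP[h _].
apply: (le_trans h); apply: fine_probability_le; try exact: measurable_itv.
by move=> u; rewrite /F/= !in_itv/= -!ler_norml => /le_trans; apply.
Qed.

End normal.

Section trapezoid.
Context {R : realType}.
Implicit Types a b c u v : R.

Lemma ler_dist_max (x y x' y' e : R) : `|x - x'| <= e -> `|y - y'| <= e ->
  `|Num.max x y - Num.max x' y'| <= e.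
Proof.
rewrite !ler_norml => /andP[? ?] /andP[? ?].
case: (leP x y) => ?; case: (leP x' y') => ?; apply/andP; split; lra.
Qed.

(** For [a <= b] the inner maximum is the distance from [u] to the interval from [a] to [b]: the
    graph is a plateau of height 1 with linear flanks of width [c]. *)
Definition trapezoid a b c u : R :=
  Num.max 0 (1 - Num.max 0 (Num.max (a - u) (u - b)) / c).

Variables (a b c : R).
Hypothesis c0 : 0 < c.

Lemma trapezoid_ge0 u : 0 <= trapezoid a b c u.
Proof. by rewrite /trapezoid le_max lexx. Qed.

Lemma trapezoid_le1 u : trapezoid a b c u <= 1.
Proof.
by rewrite /trapezoid ge_max ler01/= lerBlDr lerDl mulr_ge0 ?invr_ge0 ?(ltW c0)// le_max
    lexx.
Qed.

Lemma trapezoid_norm u : `|trapezoid a b c u| <= 1.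
Proof. by rewrite ger0_norm ?trapezoid_ge0// trapezoid_le1. Qed.

Lemma trapezoid_eq1 u : a <= u <= b -> trapezoid a b c u = 1.
Proof.
move=> /andP[au ub]; rewrite /trapezoid [X in X / c]max_l; last first.
  by rewrite ge_max !subr_le0 au ub.
by rewrite mul0r subr0 max_r.
Qed.

Lemma trapezoid_eq0 u : u <= a - c \/ b + c <= u -> trapezoid a b c u = 0.
Proof.
move=> h; rewrite /trapezoid max_l// subr_le0 ler_pdivlMr// mul1r !le_max.
by case: h => h; apply/orP; right; apply/orP; [left|right]; lra.
Qed.

Lemma trapezoid_lipschitz u v : `|trapezoid a b c v - trapezoid a b c u| <= c^-1 * `|v - u|.
Proof.
have e0 : 0 <= c^-1 * `|v - u| by rewrite mulr_ge0// invr_ge0 ltW.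
apply: ler_dist_max; first by rewrite subrr normr0.
set x := Num.max 0 (Num.max (a - v) _); set y := Num.max 0 (Num.max (a - u) _).
have -> : 1 - x / c - (1 - y / c) = c^-1 * (y - x) by ring.
rewrite normrM (@gtr0_norm _ c^-1) ?invr_gt0// ler_wpM2l ?invr_ge0 ?(ltW c0)//.
apply: ler_dist_max; first by rewrite subrr normr0.
apply: ler_dist_max.
  by rewrite (_ : a - u - (a - v) = v - u)//; ring.
by rewrite distrC (_ : v - b - (u - b) = v - u)//; ring.
Qed.

Lemma trapezoid_continuous : continuous (trapezoid a b c).
Proof. exact: lipschitz_continuous trapezoid_lipschitz. Qed.

End trapezoid.


(** * From Lipschitz test functions to distribution functions *)

Section binomial_clt.
Context {R : realType}.
Variable p : R.
Hypothesis p01 : 0 < p < 1.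
Local Notation q := (1 - p).
Local Notation s := (Num.sqrt (p * q)).
Local Notation mu := (@lebesgue_measure R).
Local Notation phi := (normal_pdf 0 s).

Let pq0 : 0 < p * q.
Proof. by case/andP: p01 => ? ?; rewrite mulr_gt0// subr_gt0. Qed.

Let s0 : 0 < s. Proof. by rewrite sqrtr_gt0. Qed.

(** A pointwise Chebyshev inequality; integrated, it bounds by the variance the mass missed by a
    plateau. *)
Lemma trapezoid_sqr_ge (a b B c u : R) : 0 < B -> 0 < c -> (`|u| <= B -> a <= u <= b) ->
  1 - trapezoid a b c u <= u ^+ 2 / B ^+ 2.
Proof.
move=> B0 c0 h; have [uB|Bu] := leP `|u| B.
  by rewrite trapezoid_eq1 ?h// subrr divr_ge0 ?sqr_ge0.
apply: (@le_trans _ _ 1); first by rewrite gerBl trapezoid_ge0.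
rewrite ler_pdivlMr ?exprn_gt0// mul1r -[leRHS]real_normK ?num_real//.
by rewrite lerXn2r ?nnegrE ?(ltW B0) ?(ltW Bu).
Qed.

Lemma binexp_trap_tail n (B : R) : 0 < B ->
  1 - p * q / B ^+ 2 <= binexp p n.+1 (fun k => trapezoid (- B) B 1 (bin_std p n.+1 k)).
Proof.
move=> B0; rewrite -(binexp_std_sqr p n) mulrC -binexpZ -[X in X - _](binexp_cst p n.+1)
    -binexpB.
apply: ler_binexp => // k; rewrite lerBlDr -lerBlDl mulrC.
by apply: trapezoid_sqr_ge => // ?; rewrite -ler_norml.
Qed.

(** Stein's bound applies to [g - c * k], where [k] is a wide plateau and [c] makes the normal mean
    vanish. What remains is [c] times the gap between the two means of [k], both within [d] of 1. *)
Lemma binexp_cvg (g : R -> R) (A L : R) :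
  (forall u v, `|g v - g u| <= L * `|v - u|) ->
  (forall u, A < `|u| -> g u = 0) -> (forall u, 0 <= g u <= 1) ->
  binexp p n.+1 (fun k => g (bin_std p n.+1 k)) @[n --> \oo] -->
  (\int[mu]_u (g u * phi u))%R.
Proof.
move=> gL g0 g01; apply/cvgrPdist_le => e e0.
have cg := lipschitz_continuous gL.
have gn u : `|g u| <= 1 by case/andP: (g01 u) => ? ?; rewrite ger0_norm.
(* [d <= 1/2] keeps [Ik] at least 1/2 and so [c] at most 2; [d <= e / 4] bounds the plateau error
   [2 * d] by [e / 2]. *)
pose d := Num.min (2^-1 : R) (e / 4).
have d0 : 0 < d by rewrite lt_min invr_gt0 ltr0n/= divr_gt0.
have d2 : d <= 2^-1 by rewrite ge_min lexx.
have d4 : d <= e / 4 by rewrite ge_min lexx orbT.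
have [N HN] := normal_tail s d0.
(* [N] controls the normal tail; the other two bounds give [d * B ^+ 2 >= 1], hence
   [p * q / B ^+ 2 <= d]. *)
pose B := Num.max N%:R (Num.max 1 (d^-1)).
have BN : N%:R <= B by rewrite le_max lexx.
have B1 : 1 <= B by rewrite !le_max lexx !orbT.
have Bd : d^-1 <= B by rewrite !le_max lexx !orbT.
have B0 : 0 < B by apply: lt_le_trans B1.
pose k := trapezoid (- B) B 1.
have kn u : `|k u| <= 1 by apply: trapezoid_norm.
have ck : continuous k by apply: trapezoid_continuous.
pose Ig := (\int[mu]_u (g u * phi u))%R.
pose Ik := (\int[mu]_u (k u * phi u))%R.
have ik := integrable_mul_normal_pdf s measurableT ck kn.
have ig := integrable_mul_normal_pdf s measurableT cg gn.
have full : fine ((normal_prob 0 s : probability _ R) setT) = 1 by rewrite probability_setT.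
have Ik1 : Ik <= 1.
  rewrite -full; apply: (Rintegral_normal_le s measurableT ck kn) => u;
      last by move=> /(_ I).
  by move=> _; exact: trapezoid_le1.
have Ig1 : Ig <= 1.
  rewrite -full; apply: (Rintegral_normal_le s measurableT cg gn) => u;
      last by move=> /(_ I).
  by case/andP: (g01 u).
have Ig0 : 0 <= Ig.
  apply: Rintegral_ge0 => u _; rewrite mulr_ge0 ?normal_pdf_ge0//.
  by case/andP: (g01 u).
have Ikd : 1 - d <= Ik.
  apply: (le_trans (HN B BN)); apply: (Rintegral_normal_ge s _ ck kn).
  - exact: measurable_itv.
  - by move=> u; exact: trapezoid_ge0.
  - by move=> u /=; rewrite in_itv/= => h; rewrite /k trapezoid_eq1.
have Ik0 : 0 < Ik by lra.
pose c := Ig / Ik.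
have c0 : 0 <= c by rewrite divr_ge0// ltW.
have c2 : c <= 2 by rewrite ler_pdivrMr//; lra.
have Ih : (\int[mu]_u ((g u - c * k u) * phi u) = 0)%R.
  transitivity (\int[mu]_u (g u * phi u - c * (k u * phi u)))%R.
    by apply: eq_Rintegral => u _; ring.
  rewrite RintegralB//; last exact: (integrableZl measurableT c ik).
  by rewrite RintegralZl// -/Ig -/Ik /c divfK ?subrr// gt_eqF.
have hL u v : `|(g v - c * k v) - (g u - c * k u)| <= (L + c) * `|v - u|.
  have -> : (g v - c * k v) - (g u - c * k u) = (g v - g u) - c * (k v - k u) by ring.
  apply: (le_trans (ler_normB _ _)); rewrite mulrDl lerD// normrM ger0_norm//.
  rewrite ler_wpM2l//; have := @trapezoid_lipschitz _ (- B) B 1 ltr01 u v.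
  by rewrite invr1 mul1r.
have h0 u : Num.max A (B + 1) < `|u| -> g u - c * k u = 0.
  rewrite gt_max => /andP[Au Bu]; rewrite g0// /k trapezoid_eq0 ?mulr0 ?subrr//.
  by move: Bu; rewrite ltr_normr => /orP[] ?; [right|left]; lra.
have [K HK] := stein_cvg p01 hL h0 Ih.
have Bq : p * q / B ^+ 2 <= d.
  case/andP: p01 => p0 p1.
  rewrite ler_pdivrMr ?exprn_gt0//; have : 1 <= d * B by rewrite -ler_pdivrMl// mulr1.
  have : 1 * (1 : R) <= B * (d * B); last by nra.
  by apply: ler_pM => //; rewrite -ler_pdivrMl// mulr1.
have [M M0 KM] : exists2 M : nat, (0 < M)%N & (K / (e / 4)) ^+ 2 <= M%:R.
  exists (Num.truncn ((K / (e / 4)) ^+ 2)).+1 => //.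
  by rewrite ltW// truncnS_gt.
near=> n.
have := HK n; set En := binexp p n.+1 _ => EnK.
have EnE : En = binexp p n.+1 (fun k => g (bin_std p n.+1 k)) -
    c * binexp p n.+1 (fun j => k (bin_std p n.+1 j)).
  by rewrite /En binexpB binexpZ.
have Ek1 : binexp p n.+1 (fun j => k (bin_std p n.+1 j)) <= 1.
  rewrite -[leRHS](binexp_cst p n.+1); apply: ler_binexp => // j; exact: trapezoid_le1.
have Ekd := binexp_trap_tail n B0.
move: EnE Ek1 Ekd; rewrite -/k.
set Eg := binexp p n.+1 _; set Ek := binexp p n.+1 _ => EnE Ek1 Ekd.
have Kn : K / Num.sqrt n.+1%:R <= e / 4.
  have r0 : (0 : R) < Num.sqrt n.+1%:R by rewrite sqrtr_gt0.
  rewrite ler_pdivrMr// mulrC -ler_pdivrMr ?divr_gt0//.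
  apply: (le_trans (ler_norm _)); rewrite -sqrtr_sqr ler_wsqrtr//.
  apply: (le_trans KM); rewrite ler_nat leqW//.
  by near: n; exists M.
have IgE : Ig = c * Ik by rewrite /c divfK// gt_eqF.
rewrite distrC -/Ig; have -> : Eg - Ig = En + c * (Ek - Ik) by rewrite EnE IgE; ring.
have cd : `|c * (Ek - Ik)| <= 2 * d.
  rewrite normrM ger0_norm// ler_pM// ler_norml; apply/andP; split; lra.
apply: (le_trans (ler_normD _ _)); lra.
Unshelve. all: by end_near. Qed.

(** The indicator of the half-line up to [t] is squeezed between two trapezoids with flanks of width
    [h], up to the mass to the left of [-B]. *)
Theorem binomial_clt (t : R) :
  binexp p n.+1 (fun k => (bin_std p n.+1 k <= t)%R%:R) @[n --> \oo] -->
  normal_cdf s t.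
Proof.
apply/cvgrPdist_le => e e0.
pose peak := normal_peak s.
have peak0 : 0 < peak by rewrite normal_peak_gt0// gt_eqF.
(* Each side loses three times at most [d]: in the convergence, in the cut at [-B], and in moving
   [t] by [h]. *)
pose d := e / 4.
have d0 : 0 < d by rewrite divr_gt0.
pose h := Num.min 1 (d / peak).
have h0 : 0 < h by rewrite lt_min ltr01/= divr_gt0.
have h1 : h <= 1 by rewrite ge_min lexx.
have hd : peak * h <= d by rewrite -ler_pdivlMl// mulrC ge_min lexx orbT.
have [N HN] := normal_tail s d0.
(* The extra constraint [1 - t <= B] places [-B] to the left of [t - h], as [h <= 1]. *)
pose B := Num.max N%:R (Num.max 1 (Num.max (1 - t) (d^-1))).
have BN : N%:R <= B by rewrite le_max lexx.
have B1 : 1 <= B by rewrite !le_max lexx !orbT.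
have Bt : 1 - t <= B by rewrite !le_max lexx !orbT.
have Bd : d^-1 <= B by rewrite !le_max lexx !orbT.
have B0 : 0 < B by apply: lt_le_trans B1.
have Bq : p * q / B ^+ 2 <= d.
  case/andP: p01 => p0 p1.
  rewrite ler_pdivrMr ?exprn_gt0//.
  have : 1 * (1 : R) <= B * (d * B); last by nra.
  by apply: ler_pM => //; rewrite -ler_pdivrMl// mulr1.
have cvg_trap a b : a <= b -> binexp p n.+1 (fun k =>
    trapezoid a b h (bin_std p n.+1 k)) @[n --> \oo] -->
    (\int[mu]_u (trapezoid a b h u * phi u))%R.
  move=> ab; apply: (@binexp_cvg _ (Num.max (`|a| + h) (`|b| + h)) h^-1).
  - by move=> u v; exact: trapezoid_lipschitz.
  - move=> u; rewrite gt_max => /andP[ua ub]; apply: trapezoid_eq0 => //.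
    have := ler_norm b; have := lerNnormlW (lexx `|a|).
    have [u0|u0] := leP 0 u; [right|left].
      by move: ub; rewrite (ger0_norm u0); lra.
    by move: ua; rewrite (ltr0_norm u0); lra.
  - by move=> u; rewrite trapezoid_ge0 trapezoid_le1.
have up : (\int[mu]_u (trapezoid (- B) t h u * phi u))%R <= normal_cdf s (t + h).
  apply: (@Rintegral_normal_le _ s _ 1 [set u | u <= t + h]).
  - exact: measurable_le_set.
  - exact: trapezoid_continuous.
  - by move=> u; exact: trapezoid_norm.
  - by move=> u _; exact: trapezoid_le1.
  - by move=> u /= /negP; rewrite -ltNge => hu; rewrite trapezoid_eq0//; right; exact: ltW.
(* The half-line up to [t - h] is covered by the plateau and the complement of the interval from
   [-B] to [B]. *)
have lo : normal_cdf s (t - h) - d <= (\int[mu]_u (trapezoid (- B) (t - h) h u * phi u))%R.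
  have mB : measurable (~` `[- B, B]%classic : set (measurableTypeR R)).
    by apply: measurableC; exact: measurable_itv.
  have mD : measurable (`[- B, t - h]%classic : set (measurableTypeR R)) by exact:
      measurable_itv.
  apply: (@le_trans _ _ (fine ((normal_prob 0 s : probability _ R) `[- B, t - h]%classic))).
    have := fine_probabilityU (normal_prob 0 s : probability _ R) mB mD.
    rewrite fine_probabilityC; last exact: measurable_itv.
    have hB := HN B BN.
    have : normal_cdf s (t - h) <= fine ((normal_prob 0 s : probability _ R) (~` `[- B,
        B]%classic `|` `[- B, t - h]%classic)).
      apply: fine_probability_le; [exact: measurable_le_set|exact: measurableU|].
      move=> u /= uth; have [uB|uB] := boolP (u \in `[- B, B]).
        by right; move: uB; rewrite !in_itv/= => /andP[-> _].
      by left; apply/negP.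
    by lra.
  apply: (@Rintegral_normal_ge _ s _ 1 _ mD).
  - exact: trapezoid_continuous.
  - by move=> u; exact: trapezoid_norm.
  - by move=> u; exact: trapezoid_ge0.
  - by move=> u /=; rewrite in_itv/= => hu; rewrite trapezoid_eq1.
have cup := normal_cdf_le_add s0 (_ : t <= t + h).
have clo := normal_cdf_le_add s0 (_ : t - h <= t).
have /cvgrPdist_le /(_ _ d0) Hup := cvg_trap (- B) t ltac:(lra).
have /cvgrPdist_le /(_ _ d0) Hlo := cvg_trap (- B) (t - h) ltac:(lra).
near=> n.
have : `|(\int[mu]_u (trapezoid (- B) t h u * phi u))%R -
    binexp p n.+1 (fun k => trapezoid (- B) t h (bin_std p n.+1 k))| <= d by near: n.
have : `|(\int[mu]_u (trapezoid (- B) (t - h) h u * phi u))%R -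
    binexp p n.+1 (fun k => trapezoid (- B) (t - h) h (bin_std p n.+1 k))| <= d by near: n.
move: up lo; set Iu := (\int[mu]_u (trapezoid (- B) t h u * phi u))%R.
set Il := (\int[mu]_u (trapezoid (- B) (t - h) h u * phi u))%R => up lo.
set El := binexp p n.+1 (fun k => trapezoid (- B) (t - h) h (bin_std p n.+1 k)).
set Eu := binexp p n.+1 (fun k => trapezoid (- B) t h (bin_std p n.+1 k)).
rewrite !ler_distl => /andP[Hl1 Hl2] /andP[Hu1 Hu2].
set C := binexp p n.+1 _.
have CE : El <= C.
  apply: ler_binexp => // k; case: (leP (bin_std p n.+1 k) t) => kt /=;
      first exact: trapezoid_le1.
  by rewrite trapezoid_eq0//; right; lra.
(* To the left of [-B] the trapezoid fails to dominate the indicator; the Chebyshev term makes up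
   for it. *)
have CU : C <= Eu + p * q / B ^+ 2.
  rewrite -(binexp_std_sqr p n) mulrC -binexpZ -binexpD; apply: ler_binexp => // k.
  rewrite mulrC; case: (leP (bin_std p n.+1 k) t) => kt /=; last first.
    by rewrite addr_ge0 ?trapezoid_ge0// divr_ge0 ?sqr_ge0.
  rewrite -lerBlDl; apply: trapezoid_sqr_ge => // kB.
  by rewrite kt andbT; move: kB; rewrite ler_norml => /andP[].
have {}cup := cup ltac:(by rewrite lerDl ltW).
have {}clo := clo ltac:(by rewrite gerBl ltW).
have e1 : t + h - t = h by ring.
have e2 : t - (t - h) = h by ring.
rewrite e1 -/peak in cup; rewrite e2 -/peak in clo.
have ed : e = 4 * d by rewrite /d; field.
rewrite ed; apply/andP; split; clear -hd up lo Hl1 Hl2 Hu1 Hu2 CE CU Bq cup clo; lra.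
Unshelve. all: by end_near. Qed.

End binomial_clt.

Lemma is_derive_quadratic {R : realType} (A Q t : R) :
  is_derive t 1 (fun r : R => r * A + 2^-1 * r ^+ 2 * Q) (A + t * Q).
Proof.
have -> : (fun r : R => r * A + 2^-1 * r ^+ 2 * Q) =
    A *: (@id R) + (2^-1 * Q) *: ((@id R) ^+ 2).
  by apply/funext => r; transitivity (A * r + 2^-1 * Q * (r * r)); [ring|].
have d1 : is_derive t 1 (A *: (@id R)) (A *: 1) by exact: is_deriveZ.
have d2 : is_derive t 1 ((@id R) ^+ 2) (2%:R *: t ^+ 1 *: 1) by exact: is_deriveX.
have d3 := is_deriveZ (2^-1 * Q) d2.
apply: (is_derive_eq (is_deriveD d1 d3)).
rewrite /GRing.scale/= expr1 !mulr1; congr (_ + _).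
by rewrite mulrAC mulrA mulVf// mul1r mulrC.
Qed.

(** * Second-order Taylor formula from continuous partial derivatives *)

Section partials.
Context {R : realType} {d : nat}.
Implicit Types (F : 'rV[R]_d -> R) (x y h : 'rV[R]_d).

Lemma near_forall_ord (x : 'rV[R]_d) (Q : 'I_d -> 'rV[R]_d -> Prop) :
  (forall i, \forall y \near x, Q i y) -> \forall y \near x, forall i, Q i y.
Proof. exact: (@filter_forall _ 'I_d Q (nbhs x) (nbhs_filter x)). Qed.

Lemma ler_coord_norm h i : `|h 0 i| <= `|h|.
Proof.
rewrite [leRHS]/normr /= mx_normrE; apply/bigmax_geP; right.
by exists (ord0, i).
Qed.

Lemma is_derive_line F (a v : 'rV[R]_d) (t : R) : derivable F (a + t *: v) v ->
  is_derive t 1 (fun r => F (a + r *: v)) ('D_v F (a + t *: v)).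
Proof.
move=> dF.
have E : (fun k : R => k^-1 *: (F (a + (k *: 1 + t) *: v) - F (a + t *: v))) =
         (fun k : R => k^-1 *: (F (k *: v + (a + t *: v)) - F (a + t *: v))).
  by apply/funext => k; rewrite [k *: 1]mulr1 scalerDl addrCA.
by apply: DeriveDef; rewrite /derivable /derive /= E.
Qed.

(* The vector keeping the first [k] coordinates of [h]; [x + coord_trunc k h]
   goes from [x] to [x + h] one coordinate at a time. *)
Definition coord_trunc k h : 'rV[R]_d := \row_i (if (i < k)%N then h 0 i else 0).

Lemma coord_trunc_step k h (kd : (k < d)%N) :
  coord_trunc k.+1 h = coord_trunc k h + h 0 (Ordinal kd) *: ev (Ordinal kd).
Proof.
apply/rowP => i; rewrite !mxE eqxx/= ltnS leq_eqVlt.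
have -> : (i == Ordinal kd) = (i == k :> nat) by [].
case: eqP => [ik|_] /=; last by rewrite mulr0 addr0.
by rewrite ik ltnn add0r mulr1; congr (h 0 _); apply/val_inj.
Qed.

Lemma norm_coord_trunc_line k h (kd : (k < d)%N) (c : R) :
  `|c| <= `|h 0 (Ordinal kd)| ->
  `|coord_trunc k h + c *: ev (Ordinal kd)| <= `|h|.
Proof.
move=> ch; rewrite [leLHS]/normr /= mx_normrE; apply/bigmax_leP; split=> // -[i j] _ /=.
rewrite !mxE (ord1 i) eqxx/=.
have -> : (j == Ordinal kd) = (j == k :> nat) by [].
case: eqP => [jk|_] /=.
  by rewrite jk ltnn add0r mulr1 (le_trans ch)// ler_coord_norm.
by rewrite mulr0 addr0; case: ifP => _; rewrite ?normr0// ler_coord_norm.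
Qed.

(** Continuous partials imply differentiability: [x + h] is reached one coordinate at a time, and
    the mean value theorem on each leg evaluates a partial derivative within distance [|h|] of
    [x]. *)
Lemma partials_differentiable F (g : 'I_d -> 'rV[R]_d -> R) x :
  (forall i, {for x, continuous (g i)}) ->
  (\forall y \near x, forall i, derivable F y (ev i) /\ 'D_(ev i) F y = g i y) ->
  forall e, 0 < e -> exists2 r, 0 < r & forall h, `|h| < r ->
    `|F (x + h) - F x - \sum_i h 0 i * g i x| <= e * `|h|.
Proof.
move=> cg dF e e0.
(* There are [d] legs with an error of [e' * |h|] each; the successor also covers dimension 0. *)
pose e' := e / d.+1%:R.
have e'0 : 0 < e' by rewrite divr_gt0.
have gn : \forall y \near x, forall i, `|g i x - g i y| <= e'.
  apply: near_forall_ord => i.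
  by move/cvgrPdist_le : (cg i); exact.
have [r /= r0 Hr] := (nbhs_normP _ _).1 (filterI dF gn).
exists r => // h hr.
have xr z : `|z| <= `|h| -> (forall i, derivable F (x + z) (ev i) /\ 'D_(ev i) F (x +
    z) = g i (x + z)) /\
   (forall i, `|g i x - g i (x + z)| <= e').
  move=> zh; apply: Hr; rewrite /= opprD addNKr normrN.
  exact: le_lt_trans hr.
have -> : F (x + h) - F x = \sum_(i < d) (F (x + coord_trunc i.+1 h) - F (x +
    coord_trunc i h)).
  rewrite -(big_mkord predT (fun i => F (x + coord_trunc i.+1 h) - F (x +
      coord_trunc i h))).
  rewrite telescope_sumr//; congr (F _ - F _).
    by congr (_ + _); apply/rowP => i; rewrite mxE ltn_ord.
  by rewrite -[LHS]addr0; congr (_ + _); apply/rowP => i; rewrite !mxE.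
rewrite -sumrB; apply: (le_trans (ler_norm_sum _ _ _)).
apply: (@le_trans _ _ (\sum_(i < d) (e' * `|h|))); last first.
  rewrite sumr_const card_ord -mulr_natl mulrA ler_wpM2r//.
  rewrite /e' mulrCA ler_piMr ?(ltW e0)//.
  by rewrite ler_pdivrMr// mul1r ler_nat.
apply: ler_sum => -[k kd] _ /=; rewrite (coord_trunc_step h kd).
set ik := Ordinal kd.
have Hc c : (0 <= c <= h 0 ik) || (h 0 ik <= c <= 0) ->
    `|coord_trunc k h + c *: ev ik| <= `|h|.
  move=> /between_dist; rewrite !subr0; exact: norm_coord_trunc_line.
have [c|c /Hc ch] := @MVT_between _ (fun c => F (x + coord_trunc k h + c *: ev ik))
    (fun c => g ik (x + (coord_trunc k h + c *: ev ik))) 0 (h 0 ik).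
  move=> /Hc /xr [/(_ ik)[+ <-] _]; rewrite addrA; exact: is_derive_line.
rewrite scale0r addr0 subr0 => E; rewrite addrA E.
have [_ /(_ ik) gc] := xr _ ch.
rewrite [_ * h 0 ik]mulrC -mulrBr normrM mulrC ler_pM//; last exact: ler_coord_norm.
by rewrite distrC.
Qed.

(** The chain rule along a line, from the first-order expansion with increment [k *: v]. *)
Lemma is_derive_line_partials F (g : 'I_d -> 'rV[R]_d -> R) (a v : 'rV[R]_d) (t : R) :
  (forall i, {for a + t *: v, continuous (g i)}) ->
  (\forall y \near a + t *: v, forall i, derivable F y (ev i) /\ 'D_(ev i) F y = g i y) ->
  is_derive t 1 (fun r => F (a + r *: v)) (\sum_i v 0 i * g i (a + t *: v)).
Proof.
move=> cg dF; set L := \sum_i _.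
have cvL : (fun k : R => k^-1 *: (F (a + (k *: 1 + t) *: v) - F (a + t *: v))) @ 0^' --> L.
  apply/cvgrPdist_le => e e0.
  pose e' := e / (`|v| + 1).
  have v1 : 0 < `|v| + 1 by rewrite ltr_wpDl.
  have e'0 : 0 < e' by rewrite divr_gt0.
  have [r r0 Hr] := partials_differentiable cg dF e'0.
  near=> k.
  have k0 : k != 0 by near: k; exact: nbhs_dnbhs_neq.
  have kr : `|k *: v| < r.
    rewrite normrZ; apply: (@le_lt_trans _ _ (`|k| * (`|v| + 1))).
      by rewrite ler_wpM2l// lerDl.
    rewrite -ltr_pdivlMr//; near: k; apply: dnbhs0_lt.
    by rewrite divr_gt0.
  have := Hr _ kr.
  have -> : a + t *: v + k *: v = a + (k *: 1 + t) *: v.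
    by rewrite [k *: 1]mulr1 scalerDl -addrA [t *: v + _]addrC.
  have -> : \sum_i (k *: v) 0 i * g i (a + t *: v) = k * L.
    by rewrite /L mulr_sumr; apply: eq_bigr => i _; rewrite mxE mulrA.
  set D := F _ - F _ => HD.
  have -> : L - k^-1 *: D = - (k^-1 * (D - k * L)).
    by rewrite mulrBr mulKf// opprB.
  rewrite normrN normrM normfV ler_pdivrMl ?normr_gt0//.
  apply: (le_trans HD); rewrite normrZ mulrCA ler_wpM2l//.
  by rewrite /e' mulrAC ler_pdivrMr// ler_wpM2l ?(ltW e0)// lerDl.
by apply: DeriveDef; [apply/cvg_ex; exists L|apply/cvg_lim].
Unshelve. all: by end_near. Qed.

(** The quadratic polynomial is subtracted along the segment and the mean value theorem is used
    once. The resulting derivative combines the first-order remainders of the gradient at [x], so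
    the second partials have to be continuous at [x] only. *)
Lemma taylor2 F (G : 'I_d -> 'rV[R]_d -> R) (g : 'I_d -> 'I_d -> 'rV[R]_d -> R) x :
  (\forall y \near x, forall i, {for y, continuous (G i)}) ->
  (\forall y \near x, forall i, derivable F y (ev i) /\ 'D_(ev i) F y = G i y) ->
  (forall i j, {for x, continuous (g i j)}) ->
  (\forall y \near x, forall i j, derivable (G i) y (ev j) /\ 'D_(ev j) (G i) y = g i j
      y) ->
  forall e, 0 < e -> exists2 r, 0 < r & forall h, `|h| < r ->
    `|F (x + h) - F x - \sum_i h 0 i * G i x -
      2^-1 * \sum_i \sum_j h 0 i * h 0 j * g i j x| <= e * `|h| ^+ 2.
Proof.
move=> cG dF cg dG e e0.
pose e' := e / d.+1%:R.
have e'0 : 0 < e' by rewrite divr_gt0.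
have Gn : forall i, exists2 r, 0 < r & forall h, `|h| < r ->
    `|G i (x + h) - G i x - \sum_j h 0 j * g i j x| <= e' * `|h|.
  move=> i; apply: partials_differentiable => //.
  by apply: filterS dG => y /(_ i).
have [r1 r10 Hr1] : exists2 r, 0 < r & forall h, `|h| < r -> forall i,
    `|G i (x + h) - G i x - \sum_j h 0 j * g i j x| <= e' * `|h|.
  have : \forall h \near (0 : 'rV[R]_d), forall i,
      `|G i (x + h) - G i x - \sum_j h 0 j * g i j x| <= e' * `|h|.
    apply: near_forall_ord => i.
    have [r r0 Hr] := Gn i.
    apply/nbhs_normP; exists r => //= h; rewrite /= sub0r normrN; exact: Hr.
  move=> /nbhs_normP[r r0 Hr]; exists r => // h hr; apply: Hr.
  by rewrite /= sub0r normrN.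
(* Interiors are taken because the chain rule at a point of the segment uses the partials in a
   neighbourhood of that point. *)
have [r2 /= r20 Hr2] := (nbhs_normP _ _).1
  (filterI (nbhs_interior cG) (nbhs_interior dF)).
exists (Num.min r1 r2); first by rewrite lt_min r10 r20.
move=> h; rewrite lt_min => /andP[hr1 hr2].
pose A := \sum_i h 0 i * G i x.
pose Q := \sum_i \sum_j h 0 i * h 0 j * g i j x.
pose psi (t : R) := F (x + t *: h) - (t * A + 2^-1 * t ^+ 2 * Q).
pose dpsi (t : R) := \sum_i h 0 i * G i (x + t *: h) - (A + t * Q).
have dpsiE (t : R) : (0 <= t <= 1) || (1 <= t <= 0) -> is_derive t 1 psi (dpsi t).
  move=> /between_dist; rewrite !subr0 normr1 => t1.
  have [H1 H2] : interior (fun y => forall i, {for y, continuous (G i)}) (x + t *: h) /\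
     interior (fun y => forall i, derivable F y (ev i) /\ 'D_(ev i) F y = G i y) (x +
         t *: h).
    apply: Hr2; rewrite /= opprD addNKr normrN normrZ.
    by apply: le_lt_trans hr2; rewrite ler_piMl.
  have d1 := is_derive_line_partials (nbhs_singleton H1) H2.
  have d2 : is_derive t 1 (fun r : R => r * A + 2^-1 * r ^+ 2 * Q) (A + t * Q).
    exact: is_derive_quadratic.
  exact: (is_deriveB d1 d2).
have [c c01] := MVT_between dpsiE.
have c1 : `|c| <= 1 by have := between_dist c01; rewrite !subr0 normr1.
rewrite subr0 mulr1 /psi !scale1r scale0r addr0 mul0r expr0n/= mulr0 mul0r addr0 subr0
    mul1r expr1n mulr1.
rewrite opprD addrA => Epsi.
have -> : F (x + h) - F x - A - 2^-1 * Q = dpsi c by rewrite -Epsi; ring.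
have ch : `|c *: h| <= `|h| by rewrite normrZ ler_piMl.
have -> : dpsi c = \sum_i h 0 i * (G i (x + c *: h) - G i x - \sum_j (c *: h) 0 j * g i j
    x).
  rewrite /dpsi /A /Q mulr_sumr -big_split/= -sumrB; apply: eq_bigr => i _.
  rewrite [_ * (_ - _ - _)]mulrBr mulrBr opprD addrA; congr (_ - _).
  rewrite !mulr_sumr; apply: eq_bigr => j _; rewrite !mxE; ring.
apply: (le_trans (ler_norm_sum _ _ _)).
apply: (@le_trans _ _ (\sum_(i < d) (e' * `|h| ^+ 2))); last first.
  rewrite sumr_const card_ord -mulr_natl mulrA ler_wpM2r//.
  rewrite /e' mulrCA ler_piMr ?(ltW e0)//.
  by rewrite ler_pdivrMr// mul1r ler_nat.
apply: ler_sum => i _; rewrite normrM.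
apply: (@le_trans _ _ (`|h| * (e' * `|h|))); last by rewrite mulrCA expr2.
apply: ler_pM => //; first exact: ler_coord_norm.
apply: (le_trans (Hr1 _ (le_lt_trans ch hr1) i)).
by rewrite ler_wpM2l// ltW.
Qed.

End partials.

(** * The open simplex and Taylor's formula at its points *)

Section simplex.
Context {R : realType} {d : nat}.
Implicit Types (F : 'rV[R]_d -> R) (x y h : 'rV[R]_d).

Lemma near_simplex_int x : simplex_int x -> \forall y \near x, simplex_int y.
Proof.
move=> [x01 x1].
have c i : (fun y : 'rV[R]_d => y 0 i) @ x --> x 0 i by exact: coord_continuous.
(* If each of the [d] coordinates grows by less than [e], the sum stays below 1. *)
pose e := (1 - \sum_i x 0 i) / d.+1%:R.
have e0 : 0 < e by rewrite divr_gt0// subr_gt0.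
have H1 : nbhs x (fun y : 'rV[R]_d => forall i, 0 < y 0 i < 1).
  apply: near_forall_ord => i; have [xi0 xi1] := andP (x01 i).
  near=> y; apply/andP; split; near: y.
    exact: cvgr_gt (c i) _ xi0.
  exact: cvgr_lt (c i) _ xi1.
have H2 : nbhs x (fun y : 'rV[R]_d => forall i, y 0 i < x 0 i + e).
  by apply: near_forall_ord => i; apply: cvgr_lt (c i) _ _; rewrite ltrDl.
near=> y; split; first by near: y.
have : forall i, y 0 i < x 0 i + e by near: y.
move=> ye; apply: (@le_lt_trans _ _ (\sum_i (x 0 i + e))).
  by apply: ler_sum => i _; exact: ltW.
rewrite big_split/= sumr_const card_ord -mulr_natl -ltrBrDl /e mulrCA.
by rewrite gtr_pMr ?subr_gt0// ltr_pdivrMr// mul1r ltr_nat.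
Unshelve. all: by end_near. Qed.

Lemma simplex_int_sub x : simplex_int x -> simplexS x.
Proof.
move=> [h1 h2]; split; last exact: ltW.
by move=> i; have /andP[? ?] := h1 i; rewrite !ltW.
Qed.

Lemma within_simplex_continuous (g : 'rV[R]_d -> R) x :
  {within simplexS, continuous g} -> simplex_int x -> {for x, continuous g}.
Proof.
move=> cg xS; have := cg x.
rewrite /continuous_at -nbhs_subspace_interior//.
by apply: filterS (near_simplex_int xS); exact: simplex_int_sub.
Qed.

Lemma near_eq_continuous (f g : 'rV[R]_d -> R) x :
  (\forall y \near x, f y = g y) -> {for x, continuous g} -> {for x, continuous f}.
Proof.
move=> fg cg U /=; rewrite (nbhs_singleton fg) => /cg gU.
by apply: filterS (filterI fg gU) => y /= [->].
Qed.

Lemma C2_taylor F x : C2_on_simplex F -> simplex_int x ->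
  forall e, 0 < e -> exists2 r, 0 < r & forall h, `|h| < r ->
    `|F (x + h) - F x - \sum_i h 0 i * 'D_(ev i) F x -
      2^-1 * \sum_i \sum_j h 0 i * h 0 j * 'D_(ev j) ('D_(ev i) F) x| <=
    e * `|h| ^+ 2.
Proof.
move=> [_ [/choice[G HG] H2]] xS.
have [g Hg] : exists g : 'I_d -> 'I_d -> 'rV[R]_d -> R, forall i j,
    {within simplexS, continuous (g i j)} /\
     forall y, simplex_int y ->
       derivable ('D_(ev i) F) y (ev j) /\ 'D_(ev j) ('D_(ev i) F) y = g i j y.
  have /choice[g Hg] : forall i, exists g : 'I_d -> 'rV[R]_d -> R, forall j,
      {within simplexS, continuous (g j)} /\
       forall y, simplex_int y ->
         derivable ('D_(ev i) F) y (ev j) /\ 'D_(ev j) ('D_(ev i) F) y = g j y.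
    by move=> i; have /choice[f Hf] := H2 i; exists f.
  by exists g.
have nS := near_simplex_int xS.
have nnS := nbhs_interior nS.
have gE i j : g i j x = 'D_(ev j) ('D_(ev i) F) x by have [_ ->] := (Hg i j).2 x xS.
move=> e e0.
have [||||r r0 Hr] := @taylor2 _ _ F (fun i => 'D_(ev i) F) g x _ _ _ _ e e0.
(* The derivative of [F] agrees with the continuous [G i] on the open simplex only, so its
   continuity at [y] is transferred from a neighbourhood of [y]. *)
- apply: filterS nnS => y yS i; apply: (@near_eq_continuous _ (G i)).
    by apply: filterS yS => z zS; have [_ ->] := (HG i).2 z zS.
  apply: within_simplex_continuous (HG i).1 _; exact: nbhs_singleton yS.
- by apply: filterS nS => y yS i; have [] := (HG i).2 y yS.
- by move=> i j; exact: within_simplex_continuous (Hg i j).1 xS.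
- by apply: filterS nS => y yS i j; exact: (Hg i j).2 y yS.
exists r => // h hr; have := Hr h hr.
rewrite (_ : \sum_i \sum_j h 0 i * h 0 j * g i j x =
  \sum_i \sum_j h 0 i * h 0 j * 'D_(ev j) ('D_(ev i) F) x)//.
by apply: eq_bigr => i _; apply: eq_bigr => j _; rewrite gE.
Qed.

(** The norm is the maximum norm, attained at some coordinate. *)
Lemma sqr_norm_le h : `|h| ^+ 2 <= \sum_i h 0 i ^+ 2.
Proof.
have [->|h0] := eqVneq h 0.
  by rewrite normr0 expr0n/=; apply: sumr_ge0 => i _; exact: sqr_ge0.
have hn : `|h| != 0 by rewrite normr_eq0.
have [[i j] hE] : exists i, `|h| = `|h i.1 i.2| := mx_norm_neq0 hn.
rewrite hE /= (ord1 i) real_normK ?num_real// (bigD1 j)//= lerDl.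
by apply: sumr_ge0 => k _; exact: sqr_ge0.
Qed.

Lemma norm4_le h : `|h| ^+ 4 <= \sum_i h 0 i ^+ 4.
Proof.
have e4 (a : R) : 0 <= a ^+ 4 by rewrite (exprM _ 2 2) sqr_ge0.
have [->|h0] := eqVneq h 0.
  by rewrite normr0 expr0n/=; apply: sumr_ge0 => i _; exact: e4.
have hn : `|h| != 0 by rewrite normr_eq0.
have [[i j] hE] : exists i, `|h| = `|h i.1 i.2| := mx_norm_neq0 hn.
rewrite hE /= (ord1 i) (exprM _ 2 2) real_normK ?num_real// -exprM (bigD1 j)//= lerDl.
by apply: sumr_ge0 => k _; exact: e4.
Qed.

End simplex.

(** * Convergence of Bernstein polynomials *)

Section bernstein.
Context {R : realType} {d : nat}.
Variable x : 'rV[R]_d.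
Hypothesis xS : simplex_int x.
Local Notation E := (iidE (cat_weight x)).

Lemma cat_weight_ge0 j : 0 <= cat_weight x j.
Proof.
case: xS => x01 x1; case: j => [i|] /=; last by rewrite subr_ge0 ltW.
by case/andP: (x01 i) => /ltW.
Qed.

Let w1 := sum_cat_weight x.
Let w0 := cat_weight_ge0.

Definition cat_dev (i : 'I_d) (a : option 'I_d) : R := (a == Some i)%:R - x 0 i.

Lemma cat_dev_norm i a : `|cat_dev i a| <= 1.
Proof.
case: xS => /(_ i) /andP[? ?] _.
by rewrite /cat_dev ler_norml; case: (_ == _) => /=; apply/andP; split; lra.
Qed.

Lemma cat_weight_indic i (f : option 'I_d -> R) :
  \sum_a cat_weight x a * ((a == Some i)%:R * f a) = x 0 i * f (Some i).
Proof.
rewrite (bigD1 (Some i))//= eqxx mul1r big1 ?addr0// => a /negbTE ->.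
by rewrite mul0r mulr0.
Qed.

Lemma cat_dev_mean i : \sum_a cat_weight x a * cat_dev i a = 0.
Proof.
rewrite (eq_bigr (fun a => cat_weight x a * ((a == Some i)%:R * 1) - cat_weight x a * x 0
    i)); last first.
  by move=> a _; rewrite /cat_dev; ring.
by rewrite sumrB cat_weight_indic mulr1 -mulr_suml w1 mul1r subrr.
Qed.

Lemma cat_dev_cov i j :
  \sum_a cat_weight x a * (cat_dev i a * cat_dev j a) =
  (if i == j then x 0 i else 0) - x 0 i * x 0 j.
Proof.
rewrite (eq_bigr (fun a => cat_weight x a * ((a == Some i)%:R * cat_dev j a) -
   x 0 i * (cat_weight x a * cat_dev j a))); last first.
  by move=> a _; rewrite /cat_dev; ring.
rewrite sumrB cat_weight_indic -mulr_sumr cat_dev_mean mulr0 subr0 /cat_dev.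
rewrite (inj_eq Some_inj) mulrBr; case: eqP => _ /=; ring.
Qed.

Section fixed_degree.
Variable m : nat.
Hypothesis m0 : (0 < m)%N.
Local Notation dev s := (freq m s - x : 'rV[R]_d).

(** A deviation of the frequencies is a normalised sum of centred letters, so its moments come from
    the i.i.d. computations. *)
Lemma freq_dev s i : size s = m -> dev s 0 i = m%:R^-1 * \sum_(a <- s) cat_dev i a.
Proof.
move=> sm; rewrite !mxE /cat_dev sumrB big_const_seq count_predT sm iter_addr_0.
rewrite -[x 0 i *+ m]mulr_natl mulrBr mulKf ?pnatr_eq0 -?lt0n// mulrC; congr (_ * _ - _).
elim: s {sm} => [|a s IH]; first by rewrite big_nil.
by rewrite big_cons /= natrD IH.
Qed.

Lemma freq_dev_norm s : size s = m -> `|dev s| <= 1.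
Proof.
move=> sm; rewrite [leLHS]/normr /= mx_normrE; apply/bigmax_leP; split=> // -[i j] _ /=.
rewrite (ord1 i) freq_dev// normrM ger0_norm// ler_pdivrMl ?ltr0n// mulr1.
apply: (le_trans (ler_norm_sum _ _ _)).
apply: (@le_trans _ _ (\sum_(a <- s) 1)); first by apply: ler_sum => a _;
    exact: cat_dev_norm.
by rewrite big_const_seq count_predT sm iter_addr_0.
Qed.

Lemma freq_dev_mean i : E m (fun s => dev s 0 i) = 0.
Proof.
rewrite (@eq_iidE _ _ _ _ _ (fun s => m%:R^-1 * \sum_(a <- s) cat_dev i a)); last first.
  by move=> s; exact: freq_dev.
by rewrite iidEZ iidE1D// cat_dev_mean !mulr0.
Qed.

Lemma freq_dev_cov i j : E m (fun s => dev s 0 i * dev s 0 j) =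
  m%:R^-1 * ((if i == j then x 0 i else 0) - x 0 i * x 0 j).
Proof.
rewrite (@eq_iidE _ _ _ _ _ (fun s => m%:R^-1 ^+ 2 * ((\sum_(a <- s) cat_dev i a) *
    (\sum_(a <- s) cat_dev j a)))); last first.
  by move=> s sm; rewrite !freq_dev//; ring.
rewrite iidEZ iidE_variance ?cat_dev_mean// cat_dev_cov expr2 mulrA mulrVK//.
by rewrite unitfE pnatr_eq0 -lt0n.
Qed.

Lemma freq_dev_sqr i : E m (fun s => dev s 0 i ^+ 2) <= m%:R^-1.
Proof.
have := freq_dev_cov i i; rewrite eqxx => Ec.
rewrite (@eq_iidE _ _ _ _ _ (fun s => dev s 0 i * dev s 0 i)); last first.
  by move=> s _; rewrite expr2.
rewrite Ec ler_piMr ?invr_ge0//.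
case: xS => /(_ i) /andP[? ?] _; nra.
Qed.

Lemma freq_dev_fourth i : E m (fun s => dev s 0 i ^+ 4) <= 3 / m%:R ^+ 2.
Proof.
rewrite (@eq_iidE _ _ _ _ _ (fun s => m%:R^-1 ^+ 4 * (\sum_(a <- s) cat_dev i a) ^+ 4));
    last first.
  by move=> s sm; rewrite !freq_dev//; ring.
rewrite iidEZ.
have := iidE_fourth_moment w1 w0 m (cat_dev_mean i) (cat_dev_norm i).
have mp : (0 : R) < m%:R by rewrite ltr0n.
have i0 : 0 <= m%:R^-1 ^+ 4 :> R by rewrite exprn_ge0// invr_ge0.
move/(ler_wpM2l i0) => /le_trans; apply.
rewrite le_eqVlt; apply/orP; left; apply/eqP; field.
by rewrite gt_eqF.
Qed.

Lemma freq_dev_bound (e C : R) (H : 'rV[R]_d -> R) : 0 <= e -> 0 <= C ->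
  (forall s, size s = m -> `|H (freq m s)| <= e * `|dev s| ^+ 2 + C * `|dev s| ^+ 4) ->
  `|bernstein m H x| <= d%:R * (e / m%:R + C * (3 / m%:R ^+ 2)).
Proof.
move=> e0 C0 HH; rewrite bernsteinE; apply: (le_trans (ler_norm_iidE w0 _ _)).
apply: (@le_trans _ _ (E m (fun s => \sum_i (e * dev s 0 i ^+ 2 + C * dev s 0 i ^+ 4)))).
  apply: ler_iidE => // s sm; apply: (le_trans (HH s sm)).
  rewrite big_split/= -!mulr_sumr lerD// ler_wpM2l ?sqr_norm_le ?norm4_le//.
rewrite iidE_sum mulr_natl -[X in _ *+ X]card_ord -sumr_const; apply: ler_sum => i _.
rewrite iidED !iidEZ lerD// ler_wpM2l// ?freq_dev_sqr ?freq_dev_fourth//.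
Qed.

End fixed_degree.

(** Bernstein's proof of Weierstrass' theorem: within [r] of [x] the function is small, and farther
    away [C] is at most [C / r ^+ 2] times the squared deviation, whose mean is of order [1 / m]. *)
Lemma bernstein_small (H : 'rV[R]_d -> R) (C : R) : (forall y, `|H y| <= C) ->
  (forall e, 0 < e -> exists2 r, 0 < r & forall h, `|h| < r -> `|H (x + h)| <= e) ->
  forall e, 0 < e -> exists M : nat, forall m, (M <= m)%N -> `|bernstein m H x| <= e.
Proof.
move=> HC Hx e e0.
have e20 : 0 < e / 2 by rewrite divr_gt0.
have [r r0 Hr] := Hx _ e20.
have C0 : 0 <= C by apply: le_trans (HC 0).
pose K := d%:R * (C / r ^+ 2).
have K0 : 0 <= K by rewrite !mulr_ge0// invr_ge0 exprn_ge0// ltW.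
exists (Num.truncn (K / (e / 2))).+1 => m Mm.
have m0 : (0 < m)%N by apply: leq_trans Mm.
have mp : (0 : R) < m%:R by rewrite ltr0n.
have Km : K / m%:R <= e / 2.
  rewrite ler_pdivrMr// mulrC -ler_pdivrMr//.
  apply: (@le_trans _ _ (Num.truncn (K / (e / 2))).+1%:R); last by rewrite ler_nat.
  by rewrite ltW// truncnS_gt.
rewrite bernsteinE; apply: (le_trans (ler_norm_iidE w0 _ _)).
apply: (@le_trans _ _ (E m (fun s => e / 2 + (C / r ^+ 2) * \sum_i (freq m s - x :
    'rV[R]_d) 0 i ^+ 2))).
  apply: ler_iidE => // s sm.
  have fE : freq m s = x + (freq m s - x) :> 'rV[R]_d by rewrite addrC subrK.
  have S0 := sqr_norm_le (freq m s - x : 'rV[R]_d).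
  have Cr : 0 <= C / r ^+ 2 by rewrite divr_ge0// exprn_ge0// ltW.
  have [hr|hr] := ltP `|freq m s - x : 'rV[R]_d| r.
    rewrite fE; apply: (le_trans (Hr _ hr)); rewrite lerDl mulr_ge0//.
    by apply: sumr_ge0 => i _; exact: sqr_ge0.
  apply: (le_trans (HC _)); rewrite -[leLHS]add0r; apply: lerD; first exact: ltW.
  apply: (@le_trans _ _ ((C / r ^+ 2) * r ^+ 2)).
    by rewrite divfK// gt_eqF// exprn_gt0.
  rewrite ler_wpM2l//; apply: le_trans S0.
  by rewrite lerXn2r ?nnegrE// ltW.
rewrite iidED (iidE_cst w1) iidEZ iidE_sum.
have : C / r ^+ 2 * (\sum_i E m (fun s => (freq m s - x : 'rV[R]_d) 0 i ^+ 2)) <= K / m%:R.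
  have -> : K / m%:R = C / r ^+ 2 * (d%:R * m%:R^-1) by rewrite /K; ring.
  rewrite ler_wpM2l//.
    by rewrite divr_ge0// exprn_ge0// ltW.
  rewrite mulr_natl -[X in _ *+ X]card_ord -sumr_const; apply: ler_sum => i _.
  exact: freq_dev_sqr.
lra.
Qed.

(** The linear Taylor term has mean zero and the quadratic one has mean [biasB F x / m]. Far from
    [x] the remainder is bounded by a multiple of the fourth power of the deviation, whose mean of
    order [1 / m ^ 2] stays negligible after multiplication by [m]. *)
Lemma bernstein_voronovskaya (F : 'rV[R]_d -> R) : C2_on_simplex F ->
  (forall y, 0 <= F y <= 1) ->
  forall e, 0 < e -> exists M : nat, forall m, (M <= m)%N ->
    `|m%:R * (bernstein m F x - F x) - biasB F x| <= e.
Proof.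
move=> F2 F01 e e0.
(* The [d] coordinate variances, each at most [1 / m], turn [e'] into at most [e / 2]. *)
pose e' := e / 2 / d.+1%:R.
have e'0 : 0 < e' by rewrite !divr_gt0.
have [r r0 Hr] := C2_taylor F2 xS e'0.
pose G i := 'D_(ev i) F x.
pose g i j := 'D_(ev j) ('D_(ev i) F) x.
pose T y := F y - F x - \sum_i (y - x) 0 i * G i -
   2^-1 * \sum_i \sum_j (y - x) 0 i * (y - x) 0 j * g i j.
(* [C0] bounds the remainder [T] at all frequency vectors, since [F] lies in the unit interval and
   deviations have norm at most 1. Dividing by [r ^+ 4] makes the quartic bound valid outside the
   ball. *)
pose C0 := 1 + \sum_i `|G i| + 2^-1 * \sum_i \sum_j `|g i j|.
have C00 : 0 <= C0.
  rewrite !addr_ge0 ?mulr_ge0//; first by apply: sumr_ge0.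
  by apply: sumr_ge0 => i _; apply: sumr_ge0.
pose C := C0 / r ^+ 4.
have r4 : 0 < r ^+ 4 by rewrite exprn_gt0.
have C'0 : 0 <= C by rewrite divr_ge0// ltW.
pose K := d%:R * C * 3.
exists (Num.truncn (K / (e / 2))).+1 => m Mm.
have m0 : (0 < m)%N by apply: leq_trans Mm.
have mp : (0 : R) < m%:R by rewrite ltr0n.
have Km : K / m%:R <= e / 2.
  rewrite ler_pdivrMr// mulrC -ler_pdivrMr ?divr_gt0//.
  apply: (@le_trans _ _ (Num.truncn (K / (e / 2))).+1%:R); last by rewrite ler_nat.
  by rewrite ltW// truncnS_gt.
have TE : m%:R * (bernstein m F x - F x) - biasB F x = m%:R * bernstein m T x.
  rewrite !bernsteinE /T.
  rewrite (@eq_iidE _ _ _ _ (fun s => T (freq m s)) (fun s => F (freq m s) + ((- F x) +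
     ((-1) * \sum_i (freq m s - x : 'rV[R]_d) 0 i * G i +
      (- 2^-1) * \sum_i \sum_j (freq m s - x : 'rV[R]_d) 0 i * (freq m s - x : 'rV[R]_d)
          0 j * g i j)))); last first.
    by move=> s _; rewrite /T mulN1r mulNr !addrA.
  rewrite !iidED !iidEZ (iidE_cst w1) !iidE_sum.
  rewrite [X in -1 * X]big1; last first.
    move=> i _; rewrite (@eq_iidE _ _ _ _ _ (fun s => G i * (freq m s - x : 'rV[R]_d) 0 i)).
      by rewrite iidEZ freq_dev_mean// mulr0.
    by move=> s _; rewrite mulrC.
  rewrite [X in - 2^-1 * X](eq_bigr (fun i => \sum_j m%:R^-1 *
      (((if i == j then x 0 i else 0) - x 0 i * x 0 j) * g i j))); last first.
    move=> i _; rewrite iidE_sum; apply: eq_bigr => j _.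
    rewrite (@eq_iidE _ _ _ _ _ (fun s => g i j * ((freq m s - x : 'rV[R]_d) 0 i * (freq
        m s - x : 'rV[R]_d) 0 j))).
      by rewrite iidEZ freq_dev_cov// mulrCA [g i j * _]mulrC.
    by move=> s _; rewrite mulrC.
  under eq_bigr do rewrite -mulr_sumr.
  rewrite -mulr_sumr /biasB -/g.
  set Q := (X in 2^-1 * X); set Q' := (X in m%:R^-1 * X); set EF := E m _.
  have -> : Q = Q' by [].
  field.
  by rewrite gt_eqF.
rewrite TE normrM ger0_norm//.
have TB s : size s = m -> `|T (freq m s)| <= e' * `|freq m s - x : 'rV[R]_d| ^+ 2 +
     C * `|freq m s - x : 'rV[R]_d| ^+ 4.
  move=> sm; set h := freq m s - x : 'rV[R]_d.
  have h1 : `|h| <= 1 by exact: freq_dev_norm.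
  have fE : freq m s = x + h by rewrite /h addrC subrK.
  have [hr|hr] := ltP `|h| r.
    rewrite -[leLHS]addr0 lerD//; last by rewrite mulr_ge0// exprn_ge0.
    by have := Hr h hr; rewrite /T -/h fE.
  apply: (@le_trans _ _ C0); last first.
    rewrite -[leLHS]add0r lerD//; first by rewrite mulr_ge0 ?exprn_ge0// ltW.
    rewrite /C mulrAC ler_pdivlMr// ler_wpM2l//.
    by rewrite lerXn2r ?nnegrE ?(ltW r0).
  have hi i : `|h 0 i| <= 1 by apply: le_trans h1; exact: ler_coord_norm.
  rewrite /T -/h /C0; apply: (le_trans (ler_normB _ _)); apply: lerD.
    apply: (le_trans (ler_normB _ _)); apply: lerD.
      have := F01 (freq m s); have := F01 x; rewrite ler_norml.
      by move=> /andP[? ?] /andP[? ?]; apply/andP; split; lra.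
    apply: (le_trans (ler_norm_sum _ _ _)); apply: ler_sum => i _.
    by rewrite normrM ler_piMl.
  rewrite normrM ger0_norm// ler_wpM2l//.
  apply: (le_trans (ler_norm_sum _ _ _)); apply: ler_sum => i _.
  apply: (le_trans (ler_norm_sum _ _ _)); apply: ler_sum => j _.
  by rewrite !normrM ler_piMl// mulr_ile1.
have := freq_dev_bound m0 (ltW e'0) C'0 TB.
move=> /(ler_wpM2l (ltW mp)) /le_trans; apply.
have -> : m%:R * (d%:R * (e' / m%:R + C * (3 / m%:R ^+ 2))) = d%:R * e' + K / m%:R.
  by rewrite /K; field; rewrite gt_eqF.
have : d%:R * e' <= e / 2.
  by rewrite /e' mulrCA ler_piMr ?divr_ge0 ?ltW// ltr_pdivrMr// mul1r ltr_nat.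
lra.
Qed.

End bernstein.

(** * The empirical process *)

Section count_law.
Context {R : realType} {dm : measure_display} {T : measurableType dm}.
Variables (P : probability T R) (b : nat -> T -> bool) (p : R).
Hypothesis mb : forall i, measurable [set w | b i w].
Hypothesis Pb : forall s, uniq s ->
  fine (P [set w | all (fun i => b i w) s]) = p ^+ size s.

Lemma measurable_count (r : seq nat) (Q : nat -> bool) :
  measurable [set w | Q (count (fun i => b i w) r)].
Proof.
elim: r Q => [|a r IH] Q /=.
  case: (Q 0%N); first by rewrite (_ : [set _ | _] = setT)//; apply/seteqP; split.
  by rewrite (_ : [set _ | _] = set0)//; apply/seteqP; split.
rewrite (_ : [set _ | _] =
   ([set w | b a w] `&` [set w | Q (count (fun i => b i w) r).+1]) `|`
   (~` [set w | b a w] `&` [set w | Q (count (fun i => b i w) r)])).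
  apply: measurableU; apply: measurableI; rewrite ?measurableC//.
  - exact: (IH (fun k => Q k.+1)).
  - exact: measurableC.
apply/seteqP; split => w /=.
  case E : (b a w) => /= QE; [left|right]; split => //.
by case=> -[E QE]; [rewrite E|move/negP/negbTE: E => ->].
Qed.

Lemma measurable_all (s : seq nat) : measurable [set w | all (fun i => b i w) s].
Proof.
elim: s => [|a s IH] /=; first by rewrite (_ : [set _ | _] = setT)//; apply/seteqP.
rewrite (_ : [set _ | _] = [set w | b a w] `&` [set w | all (fun i => b i w) s]).
  exact: measurableI.
by apply/seteqP; split => w /= => [/andP[]|[-> ->]].
Qed.

Lemma measurable_all_count (s r : seq nat) (Q : nat -> bool) :
  measurable [set w | all (fun i => b i w) s && Q (count (fun i => b i w) r)].
Proof.
rewrite (_ : [set _ | _] = [set w | all (fun i => b i w) s] `&`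
    [set w | Q (count (fun i => b i w) r)]).
  by apply: measurableI; [exact: measurable_all|exact: measurable_count].
by apply/seteqP; split => w /= => [/andP[]|[-> ->]].
Qed.

(* The conjunction over [s] is what makes the induction on [r] go through:
   conditioning on the first event of [r] moves its index to [s], and its
   complement is handled by subtraction. *)
Lemma count_law_cond (r s : seq nat) (Q : nat -> bool) :
  uniq s -> uniq r -> (forall i, i \in r -> i \notin s) ->
  fine (P [set w | all (fun i => b i w) s && Q (count (fun i => b i w) r)]) =
  p ^+ size s * binexp p (size r) (fun k => (Q k)%:R).
Proof.
elim: r s Q => [|a r IH] s Q us /=.
  move=> _ _; rewrite /binexp /=; case: (Q 0%N); last first.
    rewrite mulr0 (_ : [set _ | _] = set0) ?measure0//.
    by apply/seteqP; split => // w /=; rewrite andbF.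
  rewrite mulr1 -Pb//; congr (fine (P _)).
  by apply/seteqP; split => w /=; rewrite andbT.
move=> /andP[ar ur] rs.
have as_ : a \notin s by apply: rs; rewrite mem_head.
have uas : uniq (a :: s) by rewrite /= as_.
have ras i : i \in r -> i \notin a :: s.
  move=> ir; rewrite inE negb_or rs ?inE ?ir ?orbT// andbT.
  by apply: contraNneq ar => <-.
have rs' i : i \in r -> i \notin s by move=> ir; apply: rs; rewrite inE ir orbT.
pose A := [set w | all (fun i => b i w) (a :: s) && Q (count (fun i => b i w) r).+1].
pose B := [set w | all (fun i => b i w) s && Q (count (fun i => b i w) r)].
pose C := [set w | all (fun i => b i w) (a :: s) && Q (count (fun i => b i w) r)].
have mA : measurable A := measurable_all_count (a :: s) r (fun k => Q k.+1).
have mB : measurable B := measurable_all_count s r Q.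
have mC : measurable C := measurable_all_count (a :: s) r Q.
have CB : C `<=` B by move=> w /andP[/andP[_ ha] hQ]; apply/andP.
(* Split on the event [a]: if it holds the count grows by one, giving [A]; if it fails, what remains
   is [B] without [C]. *)
have -> : [set w | all (fun i => b i w) s && Q (b a w + count (fun i => b i w) r)%N] =
    A `|` (B `\` C).
  apply/seteqP; split => w; rewrite /A /B /C /=; case: (b a w) => //=.
  - by left.
  - by right.
  - by case=> // -[h []].
  - by case=> // -[].
have PBC : P (B `\` C) = (P B - P C)%E.
  have PB : (P B < +oo)%E by rewrite ltey_eq fin_num_measure.
  by rewrite measureD//; congr (_ - P _)%E; exact: setIidr.
have PU : P (A `|` (B `\` C)) = (P A + P (B `\` C))%E.
  apply: measureU => //; first exact: measurableD.
  apply/seteqP; split => // w [/andP[h _] [/andP[_ hQ] hC]].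
  by apply: hC; apply/andP.
rewrite PU PBC fineD ?fineB ?fin_numB ?fin_num_measure//.
rewrite (IH (a :: s) (fun k => Q k.+1))// (IH s Q)// (IH (a :: s) Q)//= binexpS exprS; ring.
Qed.

Lemma count_law (n : nat) (Q : nat -> bool) :
  fine (P [set w | Q (count (fun i => b i w) (iota 0 n))]) =
  binexp p n (fun k => (Q k)%:R).
Proof.
have := @count_law_cond (iota 0 n) [::] Q isT (iota_uniq 0 n) (fun _ _ => isT).
by rewrite expr0 mul1r size_iota.
Qed.

End count_law.

(** * Bounded random variables and their means *)

Section bounded_measurable.
Context {R : realType} {dm : measure_display} {T : measurableType dm}.
Variable P : probability T R.
Implicit Types f g : T -> R.

(** A class stable under sums and products and contained in the integrable functions, so that
    linearity of the mean needs no further integrability argument. *)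
Definition bmeas f := measurable_fun setT f /\ exists M, forall w, `|f w| <= M.

Lemma bmeas_integrable f : bmeas f -> P.-integrable setT (EFin \o f).
Proof.
move=> [mf [M fM]].
apply: (@le_integrable _ _ _ P setT measurableT _ (EFin \o cst M)).
- exact/measurable_EFinP.
- by move=> w _ /=; rewrite lee_fin (le_trans (fM w))// ler_norm.
- exact: finite_measure_integrable_cst.
Qed.

Lemma bmeas_cst c : bmeas (fun=> c).
Proof. by split; [exact: measurable_cst|exists `|c|]. Qed.

Lemma bmeasD f g : bmeas f -> bmeas g -> bmeas (fun w => f w + g w).
Proof.
move=> [mf [M fM]] [mg [N gN]]; split; first exact: measurable_funD.
by exists (M + N) => w; apply: (le_trans (ler_normD _ _)); exact: lerD.
Qed.

Lemma bmeasM f g : bmeas f -> bmeas g -> bmeas (fun w => f w * g w).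
Proof.
move=> [mf [M fM]] [mg [N gN]]; split; first exact: measurable_funM.
by exists (M * N) => w; rewrite normrM; apply: ler_pM.
Qed.

Lemma bmeas_sum I (r : seq I) (Q : pred I) (f : I -> T -> R) :
  (forall i, bmeas (f i)) -> bmeas (fun w => \sum_(i <- r | Q i) f i w).
Proof.
move=> bf; elim: r => [|i r IH].
  rewrite (_ : (fun _ => _) = fun=> 0); first exact: bmeas_cst.
  by apply/funext => w; rewrite big_nil.
case: (boolP (Q i)) => Qi.
  rewrite (_ : (fun _ => _) = fun w => f i w + \sum_(j <- r | Q j) f j w).
    exact: bmeasD.
  by apply/funext => w; rewrite big_cons Qi.
rewrite (_ : (fun _ => _) = fun w => \sum_(j <- r | Q j) f j w)//.
by apply/funext => w; rewrite big_cons (negbTE Qi).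
Qed.

Definition mean f : R := (\int[P]_w f w)%R.

Lemma mean_cst c : mean (fun=> c) = c.
Proof.
transitivity (c * fine (P setT)); first exact: Rintegral_cst.
by rewrite probability_setT mulr1.
Qed.

Lemma meanD f g : bmeas f -> bmeas g -> mean (fun w => f w + g w) = mean f + mean g.
Proof. by move=> bf bg; apply: RintegralD => //; exact: bmeas_integrable. Qed.

Lemma meanZ c f : bmeas f -> mean (fun w => c * f w) = c * mean f.
Proof. by move=> bf; apply: RintegralZl => //; exact: bmeas_integrable. Qed.

Lemma le_mean f g : bmeas f -> bmeas g -> (forall w, f w <= g w) -> mean f <= mean g.
Proof. by move=> bf bg fg; apply: le_Rintegral => //; exact: bmeas_integrable. Qed.

Lemma mean_sum I (r : seq I) (Q : pred I) (f : I -> T -> R) :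
  (forall i, bmeas (f i)) ->
  mean (fun w => \sum_(i <- r | Q i) f i w) = \sum_(i <- r | Q i) mean (f i).
Proof.
move=> bf; elim: r => [|i r IH].
  rewrite big_nil -[RHS](mean_cst 0); congr mean.
  by apply/funext => w; rewrite big_nil.
rewrite big_cons -IH; case: (boolP (Q i)) => Qi.
  rewrite -meanD//; last exact: bmeas_sum.
  by congr mean; apply/funext => w; rewrite big_cons Qi.
by congr mean; apply/funext => w; rewrite big_cons (negbTE Qi).
Qed.

Lemma bmeas_indic (A : T -> bool) : measurable [set w | A w] -> bmeas (fun w => (A w)%:R).
Proof.
move=> mA; split; last by exists 1 => w; case: (A w); rewrite ?normr1 ?normr0.
rewrite (_ : (fun _ => _) = \1_[set w | A w]); first exact: measurable_indic.
apply/funext => w; rewrite indicE; congr (nat_of_bool _)%:R.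
by apply/idP/idP; rewrite inE.
Qed.

Lemma mean_indic (A : T -> bool) : measurable [set w | A w] ->
  mean (fun w => (A w)%:R) = fine (P [set w | A w]).
Proof.
move=> mA; rewrite /mean /Rintegral.
rewrite (_ : (fun w => ((A w)%:R)%:E) = EFin \o \1_[set w | A w]).
  by rewrite integral_indic// setIT.
apply/funext => w /=; rewrite indicE; congr (nat_of_bool _)%:R%:E.
by apply/idP/idP; rewrite inE.
Qed.

Lemma chebyshev_mean f (e : R) : bmeas f -> 0 < e ->
  fine (P [set w | e <= `|f w|]) <= mean (fun w => f w * f w) / e ^+ 2.
Proof.
move=> bf e0.
have mA : measurable [set w | e <= `|f w|].
  have mf : measurable_fun setT (fun w => `|f w|) by apply: measurableT_comp => //;
      exact: bf.1.
  rewrite (_ : [set _ | _] = setT `&` [set w | cst e w <= `|f w|]); last by rewrite setTI.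
  exact: measurable_fun_le.
rewrite -mean_indic// ler_pdivlMr ?exprn_gt0// mulrC -meanZ; last exact: bmeas_indic.
apply: le_mean; [|exact: bmeasM|].
  by apply: bmeasM; [exact: bmeas_cst|exact: bmeas_indic].
move=> w; case: (boolP (e <= `|f w|)) => /= ef; last by rewrite mulr0 -expr2 sqr_ge0.
by rewrite mulr1 -expr2 -[leRHS]real_normK ?num_real// lerXn2r ?nnegrE// ltW.
Qed.

End bounded_measurable.

(** * Slutsky's lemma and shifts of the normal law *)

Section slutsky.
Context {R : realType} {dm : measure_display} {T : measurableType dm}.
Variable P : probability T R.

Lemma measurable_le_fun (f : T -> R) (t : R) : measurable_fun setT f ->
  measurable [set w | f w <= t].
Proof.
move=> mf; rewrite (_ : [set _ | _] = setT `&` [set w | f w <= cst t w]);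
    last by rewrite setTI.
exact: measurable_fun_le.
Qed.

Lemma measurable_ge_norm (f : T -> R) (t : R) : measurable_fun setT f ->
  measurable [set w | t <= `|f w|].
Proof.
move=> mf; rewrite (_ : [set _ | _] = setT `&` [set w | cst t w <= `|f w|]);
    last by rewrite setTI.
by apply: measurable_fun_le => //; apply: measurableT_comp.
Qed.

(** When [|V n|] is below [h] and [b n] is within [h] of [c], the event for the sum lies between
    those of [W n] at [t - c - 2 * h] and [t - c + 2 * h]; the Lipschitz distribution function
    absorbs the shift. *)
Lemma slutsky_normal (s : R) (W V : nat -> T -> R) (b : nat -> R) (c : R) : 0 < s ->
  (forall n, measurable_fun setT (W n)) -> (forall n, measurable_fun setT (V n)) ->
  (forall t, fine (P [set w | W n w <= t]) @[n --> \oo] --> normal_cdf s t) ->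
  (forall e d, 0 < e -> 0 < d -> \forall n \near \oo,
      fine (P [set w | e <= `|V n w|]) <= d) ->
  b @ \oo --> c ->
  forall t, fine (P [set w | W n w + V n w + b n <= t]) @[n --> \oo] --> normal_cdf s (t
      - c).
Proof.
move=> s0 mW mV cW cV cb t; apply/cvgrPdist_le => e e0.
pose peak := normal_peak s.
have peak0 : 0 < peak by rewrite normal_peak_gt0// gt_eqF.
pose d := e / 3.
have d0 : 0 < d by rewrite divr_gt0.
(* With this [h], a shift by [2 * h] changes the normal distribution function by at most [d]. *)
pose h := d / (2 * peak).
have h0 : 0 < h by rewrite divr_gt0// mulr_gt0.
have hd : peak * (2 * h) = d by rewrite /h; field; rewrite gt_eqF.
have cup := normal_cdf_le_add s0 (_ : t - c <= t - c + 2 * h).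
have clo := normal_cdf_le_add s0 (_ : t - c - 2 * h <= t - c).
have {}cup := cup ltac:(by rewrite lerDl mulr_ge0// ltW).
have {}clo := clo ltac:(by rewrite gerBl mulr_ge0// ltW).
rewrite (_ : t - c + 2 * h - (t - c) = 2 * h) in cup; last by ring.
rewrite (_ : t - c - (t - c - 2 * h) = 2 * h) in clo; last by ring.
rewrite -/peak hd in cup; rewrite -/peak hd in clo.
have /cvgrPdist_le /(_ _ d0) Hu := cW (t - c + 2 * h).
have /cvgrPdist_le /(_ _ d0) Hl := cW (t - c - 2 * h).
have HV := cV _ _ h0 d0.
have /cvgrPdist_le /(_ _ h0) Hb := cb.
near=> n.
have : `|normal_cdf s (t - c + 2 * h) - fine (P [set w | W n w <= t - c +
    2 * h])| <= d by near: n.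
have : `|normal_cdf s (t - c - 2 * h) - fine (P [set w | W n w <= t - c - 2 * h])| <= d
    by near: n.
have : `|c - b n| <= h by near: n.
have : fine (P [set w | h <= `|V n w|]) <= d by near: n.
have mU u : measurable [set w | W n w <= u] by exact: measurable_le_fun.
have mE : measurable [set w | h <= `|V n w|] by exact: measurable_ge_norm.
have mY : measurable [set w | W n w + V n w + b n <= t].
  by apply: measurable_le_fun; apply: measurable_funD => //; exact: measurable_funD.
move=> HVn; rewrite ler_norml => /andP[b1 b2].
have up : fine (P [set w | W n w + V n w + b n <= t]) <=
    fine (P [set w | W n w <= t - c + 2 * h]) + fine (P [set w | h <= `|V n w|]).
  apply: le_trans (fine_probabilityU _ (mU _) mE).
  apply: fine_probability_le => //; first exact: measurableU.
  move=> w /= Yt; have [|hV] := leP h `|V n w|; [by right|left].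
  by move: hV; rewrite ltr_norml => /andP[? ?]; lra.
have lo : fine (P [set w | W n w <= t - c - 2 * h]) <=
    fine (P [set w | W n w + V n w + b n <= t]) + fine (P [set w | h <= `|V n w|]).
  apply: le_trans (fine_probabilityU _ mY mE).
  apply: fine_probability_le => //; first exact: measurableU.
  move=> w /= Yt; have [|hV] := leP h `|V n w|; [by right|left].
  by move: hV; rewrite ltr_norml => /andP[? ?]; lra.
rewrite !ler_distl => /andP[l1 l2] /andP[u1 u2].
have ed : e = 3 * d by rewrite /d; field.
rewrite ed; apply/andP; split; clear -cup clo HVn up lo l1 l2 u1 u2; lra.
Unshelve. all: by end_near. Qed.

End slutsky.

Section normal_shift.
Context {R : realType}.
Local Notation mu := (@lebesgue_measure R).

Lemma normal_prob_shift (s c t : R) : s != 0 ->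
  fine (normal_prob c s [set u | u <= t]) = normal_cdf s (t - c).
Proof.
move=> s0; rewrite /normal_cdf /normal_prob -!set_itvNyc.
pose F (u : R) : R := u - c.
have dF (u : R) : is_derive u 1 F 1.
  have -> : F = (@id R) - cst c by apply/funext.
  by apply: is_derive_eq; rewrite subr0.
have F1 : F^`()%classic = cst 1.
  by apply/funext => u; rewrite derive1E; exact: derive_val.
have cF : continuous F by apply: is_derive_continuous dF.
have := @increasing_ge0_integration_by_substitutionNy R F (normal_pdf 0 s) t.
move=> ->.
- congr fine; apply: eq_integral => u _ /=.
  rewrite F1 /= !fctE /= mulr1; congr EFin.
  by rewrite !normal_pdfE// /normal_fun subr0.
- by move=> u v _ _ uv; rewrite /F ltrD2r.
- by rewrite F1 => u _; exact: cvg_cst.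
- by rewrite F1; exact: is_cvg_cst.
- by rewrite F1; exact: cvg_cst.
- split; first by move=> u _; have [] := dF u.
  by apply: cvg_at_left_filter; exact: cF.
- exact: cvg_addrr_Ny.
- by apply: continuous_subspaceT; exact: continuous_normal_pdf.
- by move=> u _; exact: normal_pdf_ge0.
Qed.

End normal_shift.

(** * Affine invariance, Jensen's inequality and monotonicity of the Bernstein operator *)

Section bernstein_operator.
Context {R : realType} {d : nat}.
Implicit Types (x : 'rV[R]_d) (G H : 'rV[R]_d -> R).

Lemma bernstein_affine m (a b c : R) G H x :
  bernstein m (fun y => a * (G y - H y - b) + c) x =
  a * (bernstein m G x - bernstein m H x - b) + c.
Proof.
rewrite !bernsteinE.
rewrite (@eq_iidE _ _ _ _ _ (fun s => a * G (freq m s) + ((- a) * H (freq m s) +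
    (c - a * b)))).
  by rewrite !iidED !iidEZ !(iidE_cst (sum_cat_weight x)); ring.
by move=> s _; ring.
Qed.

(** Jensen's inequality, in the form that a variance under the multinomial law is nonnegative. *)
Lemma bernstein_sqr_le m G x : simplex_int x ->
  bernstein m G x * bernstein m G x <= bernstein m (fun y => G y * G y) x.
Proof.
move=> xS; rewrite !bernsteinE; set c := iidE _ _ _.
have : 0 <= iidE (cat_weight x) m (fun s => (G (freq m s) - c) ^+ 2).
  rewrite -[leLHS](iidE_cst (sum_cat_weight x) m); apply: ler_iidE => [|s _].
    exact: cat_weight_ge0.
  exact: sqr_ge0.
rewrite (@eq_iidE _ _ _ _ _ (fun s => G (freq m s) * G (freq m s) +
    ((- 2 * c) * G (freq m s) + c * c))).
  rewrite !iidED !iidEZ (iidE_cst (sum_cat_weight x)) -/c => h.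
  by rewrite -subr_ge0 (le_trans h)// le_eqVlt; apply/orP; left; apply/eqP; ring.
by move=> s _; ring.
Qed.

Lemma bernstein_le m G H x : simplex_int x -> (forall y, G y <= H y) ->
  bernstein m G x <= bernstein m H x.
Proof.
move=> xS GH; rewrite !bernsteinE; apply: ler_iidE => [|s _]; last exact: GH.
exact: cat_weight_ge0.
Qed.

End bernstein_operator.

(** * Moments and limit law of the empirical distribution function *)

Section iid.
Context {R : realType} {d : nat} {dm : measure_display} {T : measurableType dm}.
Variables (P : probability T R) (X : nat -> T -> 'rV[R]_d) (F : 'rV[R]_d -> R).
Hypothesis mX : forall n (i : 'I_d), measurable_fun setT (fun w => X n w 0 i).
Hypothesis iidX : forall (s : seq nat), uniq s -> forall y : nat -> 'rV[R]_d,
  P (\bigcap_(i in [set i | i \in s]) [set w | vle (X i w) (y i)])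
    = (\prod_(i <- s) F (y i))%:E.

Lemma measurable_vle i (y : 'rV[R]_d) : measurable [set w | vle (X i w) y].
Proof.
rewrite (_ : [set _ | _] = \bigcap_(j in [set: 'I_d]) [set w | X i w 0 j <= y 0 j]).
  apply: fin_bigcap_measurable; first exact: finite_finset.
  by move=> j _; exact: measurable_le_fun.
apply/seteqP; split => w /=; first by move=> /forallP h j _; exact: h.
by move=> h; apply/forallP => j; exact: h.
Qed.

Lemma prob_all_vle (s : seq nat) (y : nat -> 'rV[R]_d) : uniq s ->
  fine (P [set w | all (fun i => vle (X i w) (y i)) s]) = \prod_(i <- s) F (y i).
Proof.
move=> us; rewrite -[RHS]/(fine (\prod_(i <- s) F (y i))%:E) -iidX//.
congr (fine (P _)); apply/seteqP; split => w /=.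
  by move=> /allP h i /= /h.
by move=> h; apply/allP => i; exact: h.
Qed.

Lemma prob_vle i y : fine (P [set w | vle (X i w) y]) = F y.
Proof.
have := @prob_all_vle [:: i] (fun=> y) isT; rewrite big_seq1 => <-.
by congr (fine (P _)); apply/seteqP; split => w /=; rewrite andbT.
Qed.

Lemma prob_vle2 i j y z : i != j ->
  fine (P [set w | vle (X i w) y && vle (X j w) z]) = F y * F z.
Proof.
move=> ij; have := @prob_all_vle [:: i; j] (fun k => if k == i then y else z).
rewrite /= inE ij big_cons big_seq1 eqxx eq_sym (negbTE ij) => <-//.
by congr (fine (P _)); apply/seteqP; split => w /=; rewrite ?andbT.
Qed.

Lemma cdf01 y : 0 <= F y <= 1.
Proof.
rewrite -(prob_vle 0) fine_probability_ge0 fine_probability_le1//.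
exact: measurable_vle.
Qed.

Definition meet_rV (y z : 'rV[R]_d) : 'rV[R]_d := \row_i Num.min (y 0 i) (z 0 i).

Lemma vle_meet (u y z : 'rV[R]_d) : vle u y && vle u z = vle u (meet_rV y z).
Proof.
apply/andP/forallP => [[/forallP uy /forallP uz] i|h].
  by rewrite mxE le_min uy uz.
by split; apply/forallP => i; have := h i; rewrite mxE le_min => /andP[].
Qed.

Definition vle_ind i y w : R := (vle (X i w) y)%:R.

Lemma bmeas_vle_ind i y : bmeas (vle_ind i y).
Proof. by apply: bmeas_indic; exact: measurable_vle. Qed.

Lemma mean_vle_ind i y : mean P (vle_ind i y) = F y.
Proof. by rewrite /vle_ind mean_indic ?prob_vle//; exact: measurable_vle. Qed.

Lemma vle_ind_mul i j y z w : vle_ind i y w * vle_ind j z w = (vle (X i w) y && vle (X j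
    w) z)%:R.
Proof. by rewrite /vle_ind -natrM mulnb. Qed.

Lemma mean_vle_ind_mul i j y z : mean P (fun w => vle_ind i y w * vle_ind j z w) =
  if i == j then F (meet_rV y z) else F y * F z.
Proof.
rewrite (_ : (fun w => _) = fun w => (vle (X i w) y && vle (X j w) z)%:R); last first.
  by apply/funext => w; exact: vle_ind_mul.
have mA : measurable [set w | vle (X i w) y && vle (X j w) z].
  rewrite (_ : [set _ | _] = [set w | vle (X i w) y] `&` [set w | vle (X j w) z]).
    by apply: measurableI; exact: measurable_vle.
  by apply/seteqP; split => w /= => [/andP[]|[-> ->]].
rewrite mean_indic//; case: eqVneq => [ij|ij]; last exact: prob_vle2.
rewrite -ij -(prob_vle i); congr (fine (P _)).
by apply/seteqP; split => w /=; rewrite vle_meet.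
Qed.

Variable x : 'rV[R]_d.

(* The probability that exactly one of [X_i <= x] and [X_i <= y] holds. *)
Definition incr_mass y := F x + F y - 2 * F (meet_rV y x).

Definition vle_dev i y w : R := vle_ind i y w + (-1 * vle_ind i x w + (F x - F y)).

Lemma bmeas_vle_dev i y : bmeas (vle_dev i y).
Proof.
apply: bmeasD; first exact: bmeas_vle_ind.
apply: bmeasD; last exact: bmeas_cst.
by apply: bmeasM; [exact: bmeas_cst|exact: bmeas_vle_ind].
Qed.

Ltac bmeas_tac := repeat first
  [exact: bmeas_vle_ind | exact: bmeas_cst | apply: bmeasD | apply: bmeasM].

(** Independence cancels distinct indices. On the diagonal the squared difference of the two
    indicators has mean [incr_mass y], from which the squared mean is subtracted. *)
Lemma mean_vle_dev_mul i j y : mean P (fun w => vle_dev i y w * vle_dev j y w) =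
  if i == j then incr_mass y - (F y - F x) ^+ 2 else 0.
Proof.
pose c := F x - F y.
rewrite (_ : (fun w => _) = fun w => vle_ind i y w * vle_ind j y w +
    (-1 * (vle_ind i y w * vle_ind j x w) +
  (-1 * (vle_ind i x w * vle_ind j y w) + (vle_ind i x w * vle_ind j x w +
      (c * vle_ind i y w + ((- c) * vle_ind i x w +
   (c * vle_ind j y w + ((- c) * vle_ind j x w + c * c)))))))); last first.
  by apply/funext => w; rewrite /vle_dev -/c; ring.
rewrite !meanD; try by bmeas_tac.
rewrite !meanZ ?mean_cst; try by bmeas_tac.
rewrite !mean_vle_ind !mean_vle_ind_mul /incr_mass /c; case: eqVneq => [ij|ij];
    last by ring.
have -> : meet_rV x y = meet_rV y x by apply/rowP => k; rewrite !mxE minC.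
have -> : meet_rV x x = x by apply/rowP => k; rewrite !mxE minxx.
have -> : meet_rV y y = y by apply/rowP => k; rewrite !mxE minxx.
ring.
Qed.

Definition cdf_fluct_diff n y w : R :=
  Num.sqrt n%:R * (emp_cdf X n w y - F y - (emp_cdf X n w x - F x)).

Lemma emp_cdfE n w y : emp_cdf X n w y = n%:R^-1 * \sum_(i < n) vle_ind i y w.
Proof.
by congr (_ * _); apply: eq_bigr => i _; rewrite /vle_ind; case: (vle _ _).
Qed.

Lemma bmeas_emp_cdf n y : bmeas (fun w => emp_cdf X n w y).
Proof.
rewrite (_ : (fun _ => _) = fun w => n%:R^-1 * \sum_(i < n) vle_ind i y w).
  apply: bmeasM; first exact: bmeas_cst.
  by apply: bmeas_sum => i; exact: bmeas_vle_ind.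
by apply/funext => w; exact: emp_cdfE.
Qed.

Lemma cdf_fluct_diffE n y w : (0 < n)%N ->
  cdf_fluct_diff n y w = (Num.sqrt n%:R)^-1 * \sum_(i < n) vle_dev i y w.
Proof.
move=> n0; have np : (0 : R) < n%:R by rewrite ltr0n.
have r0 : 0 < Num.sqrt (n%:R : R) by rewrite sqrtr_gt0.
rewrite /cdf_fluct_diff !emp_cdfE /vle_dev big_split/= big_split/= -mulr_sumr sumr_const
    card_ord.
have rr : Num.sqrt n%:R * Num.sqrt n%:R = n%:R :> R by rewrite -expr2 sqr_sqrtr// ltW.
rewrite -[(F x - F y) *+ n]mulr_natl.
move: r0 rr; move: (Num.sqrt _) => r r0 <-; field.
by rewrite gt_eqF.
Qed.

Lemma bmeas_cdf_fluct_diff n y : bmeas (cdf_fluct_diff n y).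
Proof.
have [->|n0] := posnP n.
  rewrite (_ : cdf_fluct_diff 0 y = fun=> 0); first exact: bmeas_cst.
  by apply/funext => w; rewrite /cdf_fluct_diff sqrtr0 mul0r.
rewrite (_ : cdf_fluct_diff n y = fun w => (Num.sqrt n%:R)^-1 * \sum_(i < n) vle_dev i y w).
  apply: bmeasM; first exact: bmeas_cst.
  by apply: bmeas_sum => i; exact: bmeas_vle_dev.
by apply/funext => w; exact: cdf_fluct_diffE.
Qed.

Lemma mean_cdf_fluct_diff_sqr n y : (0 < n)%N -> mean P (fun w =>
    cdf_fluct_diff n y w * cdf_fluct_diff n y w) <= incr_mass y.
Proof.
move=> n0; have np : (0 : R) < n%:R by rewrite ltr0n.
rewrite (_ : (fun w => _) = fun w => n%:R^-1 * \sum_(i < n) \sum_(j < n) (vle_dev i y w *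
    vle_dev j y w)); last first.
  apply/funext => w; rewrite !cdf_fluct_diffE// mulrACA -invfM -expr2 sqr_sqrtr ?(ltW np)//.
  by congr (_ * _); rewrite mulr_suml; apply: eq_bigr => i _; rewrite mulr_sumr.
have bcc i j : bmeas (fun w => vle_dev i y w * vle_dev j y w) by apply: bmeasM;
    exact: bmeas_vle_dev.
rewrite meanZ; last by do 2!(apply: bmeas_sum => ?); exact: bcc.
rewrite mean_sum; last by move=> i; apply: bmeas_sum => j; exact: bcc.
rewrite (eq_bigr (fun=> incr_mass y - (F y - F x) ^+ 2)); last first.
  move=> i _; rewrite mean_sum; last by move=> j; exact: bcc.
  rewrite (bigD1 i)//= mean_vle_dev_mul eqxx big1 ?addr0// => j ji.
  by rewrite mean_vle_dev_mul; case: eqVneq => // ij;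
      rewrite -(inj_eq val_inj) /= ij eqxx in ji.
rewrite sumr_const card_ord -[X in _ * X]mulr_natl mulKf ?gt_eqF//.
by rewrite gerBl sqr_ge0.
Qed.

Hypothesis xS : simplex_int x.

Definition bern_fluct m n w : R := bernstein m (fun y => cdf_fluct_diff n y w) x.

Lemma bmeas_bernstein m (U : 'rV[R]_d -> T -> R) : (forall y, bmeas (U y)) ->
  bmeas (fun w => bernstein m (fun y => U y w) x).
Proof.
move=> bU; apply: bmeas_sum => k; apply: bmeasM; [exact: bU|exact: bmeas_cst].
Qed.

Lemma mean_bernstein m (U : 'rV[R]_d -> T -> R) : (forall y, bmeas (U y)) ->
  mean P (fun w => bernstein m (fun y => U y w) x) = bernstein m (fun y => mean P (U y)) x.
Proof.
move=> bU; rewrite /bernstein mean_sum; last first.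
  by move=> k; apply: bmeasM; [exact: bU|exact: bmeas_cst].
apply: eq_bigr => k _; rewrite mulrC -meanZ//; congr mean.
by apply/funext => w; rewrite mulrC.
Qed.

Lemma mean_bern_fluct_sqr m n : (0 < n)%N ->
  mean P (fun w => bern_fluct m n w * bern_fluct m n w) <= bernstein m incr_mass x.
Proof.
move=> n0; have bu := @bmeas_cdf_fluct_diff n.
have buu y : bmeas (fun w => cdf_fluct_diff n y w * cdf_fluct_diff n y w) by exact: bmeasM.
apply: (@le_trans _ _ (mean P (fun w => bernstein m (fun y =>
    cdf_fluct_diff n y w * cdf_fluct_diff n y w) x))).
  apply: le_mean; [apply: bmeasM; exact: bmeas_bernstein|exact: bmeas_bernstein|].
  by move=> w; exact: bernstein_sqr_le.
rewrite mean_bernstein//; apply: bernstein_le => // y.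
exact: mean_cdf_fluct_diff_sqr.
Qed.

Lemma incr_mass_norm y : `|incr_mass y| <= 2.
Proof.
rewrite /incr_mass ler_norml.
have := cdf01 x; have := cdf01 y; have := cdf01 (meet_rV y x).
by move=> /andP[? ?] /andP[? ?] /andP[? ?]; apply/andP; split; lra.
Qed.

(** The coordinatewise minimum of [x + h] and [x] is no farther from [x] than [x + h], so all three
    values of [F] are close to [F x]. *)
Lemma incr_mass_small : {for x, continuous F} ->
  forall e, 0 < e -> exists2 r, 0 < r & forall h : 'rV[R]_d,
      `|h| < r -> `|incr_mass (x + h)| <= e.
Proof.
move=> cF e e0.
have e4 : 0 < e / 4 by rewrite divr_gt0.
have nF : \forall y \near x, `|F x - F y| <= e / 4.
  by move/cvgrPdist_le : cF; exact.
have [r /= r0 Hr] := (nbhs_normP _ _).1 nF.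
exists r => // h hr.
have H1 : `|F x - F (x + h)| <= e / 4 by apply: Hr; rewrite /= opprD addNKr normrN.
have H2 : `|F x - F (meet_rV (x + h) x)| <= e / 4.
  apply: Hr; apply: le_lt_trans hr.
  rewrite [leLHS]/normr /= mx_normrE; apply/bigmax_leP; split=> // -[i j] _ /=.
  rewrite (ord1 i) !mxE; apply: le_trans (ler_coord_norm h j).
  by case: (leP (x 0 j + h 0 j) (x 0 j)) => _; rewrite ?subrr ?normr0// opprD addNKr normrN.
move: H1 H2; rewrite /incr_mass !ler_norml => /andP[? ?] /andP[? ?].
by apply/andP; split; lra.
Qed.

Lemma bern_fluct_cvg_prob (m : nat -> nat) : {for x, continuous F} ->
  ((m n)%:R : R) @[n --> \oo] --> +oo ->
  forall e d', 0 < e -> 0 < d' ->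
  \forall n \near \oo, fine (P [set w | e <= `|bern_fluct (m n) n w|]) <= d'.
Proof.
move=> cF moo e d' e0 d'0.
(* Chebyshev's inequality divides the second moment by [e ^+ 2], which leaves [d']. *)
have ed0 : 0 < d' * e ^+ 2 by rewrite mulr_gt0// exprn_gt0.
have [M HM] := bernstein_small xS incr_mass_norm (incr_mass_small cF) ed0.
have /cvgryPge /(_ M%:R) Hm := moo.
near=> n.
have n0 : (0 < n)%N by near: n; exists 1%N.
have Mm : (M <= m n)%N by rewrite -(ler_nat R); near: n.
apply: (le_trans (chebyshev_mean _ _ _)) => //; first exact: bmeas_bernstein
    (bmeas_cdf_fluct_diff n).
rewrite ler_pdivrMr ?exprn_gt0//; apply: (le_trans (mean_bern_fluct_sqr _ n0)).
exact: le_trans (ler_norm _) (HM _ Mm).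
Unshelve. all: by end_near. Qed.

Hypothesis Fx : 0 < F x < 1.

Definition cdf_fluct n w : R := Num.sqrt n%:R * (emp_cdf X n w x - F x).

Lemma cdf_fluct_clt t : fine (P [set w | cdf_fluct n w <= t]) @[n --> \oo] -->
  normal_cdf (Num.sqrt (F x * (1 - F x))) t.
Proof.
apply/cvgrPdist_le => e e0.
have /cvgrPdist_le /(_ _ e0)[N _ HN] := @binomial_clt _ _ Fx t.
(* The binomial limit is indexed by [n.+1], hence the shifted threshold, which rules out sample size
   0. *)
exists N.+1 => // -[//|n] /= Nn; have := HN n Nn; rewrite /=.
rewrite -(@count_law _ _ _ P (fun i w => vle (X i w) x) (F x) _ _ n.+1 (fun k =>
    bin_std (F x) n.+1 k <= t)) => [|i|s us].
- suff -> : [set w | cdf_fluct n.+1 w <= t] =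
    [set w | bin_std (F x) n.+1 (count (fun i => vle (X i w) x) (iota 0 n.+1)) <= t] by [].
  apply/seteqP.
  have E w : cdf_fluct n.+1 w = bin_std (F x) n.+1 (count (fun i =>
      vle (X i w) x) (iota 0 n.+1)).
    rewrite /cdf_fluct /bin_std emp_cdfE.
    have -> : \sum_(i < n.+1) vle_ind i x w = (count (fun i =>
        vle (X i w) x) (iota 0 n.+1))%:R.
      rewrite -(big_mkord predT (fun i => vle_ind i x w)) /index_iota subn0.
      elim: (iota 0 n.+1) => [|i s IH]; first by rewrite big_nil.
      by rewrite big_cons IH /= natrD.
    have rr : Num.sqrt n.+1%:R * Num.sqrt n.+1%:R = n.+1%:R :> R by rewrite -expr2
        sqr_sqrtr.
    have r0 : 0 < Num.sqrt (n.+1%:R : R) by rewrite sqrtr_gt0.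
    move: r0 rr; move: (Num.sqrt _) => r r0 <-; field.
    by rewrite gt_eqF.
  by split => w /=; rewrite E.
- exact: measurable_vle.
- by rewrite prob_all_vle// big_const_seq count_predT iter_mulr_1.
Qed.

End iid.

Theorem theorem3 (R : realType) (d : nat) (dm : measure_display)
  (T : measurableType dm) (P : probability T R)
  (X : nat -> T -> 'rV[R]_d) (F : 'rV[R]_d -> R) (x : 'rV[R]_d) :
  (0 < d)%N ->
  (* each coordinate of each X_i is a real random variable *)
  (forall n (i : 'I_d), measurable_fun setT (fun w => X n w 0 i)) ->
  (* X_1, X_2, ... are i.i.d. with c.d.f. F: the joint c.d.f. of any finite
     family of distinct X_i's is the product of copies of F *)
  (forall (s : seq nat), uniq s -> forall y : nat -> 'rV[R]_d,
     P (\bigcap_(i in [set i | i \in s]) [set w | vle (X i w) (y i)])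
       = (\prod_(i <- s) F (y i))%:E) ->
  (* the distribution is supported on S *)
  (forall n, P [set w | simplexS (X n w)] = 1%E) ->
  C2_on_simplex F ->
  simplex_int x -> 0 < F x < 1 ->
  forall m : nat -> nat, ((m n)%:R : R) @[n --> \oo] --> +oo ->
  let Y := fun n w => Num.sqrt (n%:R) *
                      (bernstein (m n) (emp_cdf X n w) x - bernstein (m n) F x) in
  let Z := fun n w => Num.sqrt (n%:R) *
                      (bernstein (m n) (emp_cdf X n w) x - F x) in
  cvg_in_law P Y (normal_prob 0 (Num.sqrt (sigma2 F x))) /\
  ((fun n => Num.sqrt (n%:R) / (m n)%:R) @ \oo --> (0 : R) ->
     cvg_in_law P Z (normal_prob 0 (Num.sqrt (sigma2 F x)))) /\
  (forall lambda : R, 0 < lambda ->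
     (fun n => Num.sqrt (n%:R) / (m n)%:R) @ \oo --> lambda ->
     cvg_in_law P Z (normal_prob (lambda * biasB F x) (Num.sqrt (sigma2 F x)))).
Proof.
move=> _ mX iidX _ F2 xS Fx m moo Y Z.
have s0 : 0 < Num.sqrt (sigma2 F x).
  by case/andP: Fx => ? ?; rewrite sqrtr_gt0 /sigma2 mulr_gt0// subr_gt0.
have cF : {for x, continuous F} by exact: within_simplex_continuous F2.1 xS.
pose W n w := cdf_fluct X F x n w.
pose V n w := bern_fluct X F x (m n) n w.
pose b n := Num.sqrt n%:R * (bernstein (m n) F x - F x).
(* Averaging [U(y)] over the weights, which sum to 1, leaves the value at [x] unchanged; the zero
   drift gives [Y] and [Z] the same shape. *)
have YE n w : Y n w = W n w + V n w + 0.
  rewrite /V /bern_fluct (_ : (fun y => _) = fun y => Num.sqrt n%:R *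
      (emp_cdf X n w y - F y - (emp_cdf X n w x - F x)) + 0).
    by rewrite bernstein_affine /Y /W /cdf_fluct; ring.
  by apply/funext => y; rewrite addr0.
have ZE n w : Z n w = W n w + V n w + b n.
  by rewrite -[W n w + V n w]addr0 -YE /Z /Y /b; ring.
have mW n : measurable_fun setT (W n).
  apply: measurable_funM => //; apply: measurable_funB => //.
  exact: (bmeas_emp_cdf mX n x).1.
have mV n : measurable_fun setT (V n).
  apply: (proj1 (_ : bmeas (V n))); apply: bmeas_bernstein => y.
  exact: (bmeas_cdf_fluct_diff F mX x n y).
have cW t : fine (P [set w | W n w <= t]) @[n --> \oo] -->
    normal_cdf (Num.sqrt (sigma2 F x)) t by exact: cdf_fluct_clt.
have cV e d' : 0 < e -> 0 < d' ->
    \forall n \near \oo, fine (P [set w | e <= `|V n w|]) <= d'.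
  exact: bern_fluct_cvg_prob.
have slut c l := @slutsky_normal _ _ _ P _ W V c l s0 mW mV cW cV.
(* The bias is [sqrt n / m] times the quantity in Voronovskaya's theorem; [lambda = 0] gives the
   unbiased regime. *)
have bcvg lambda : (fun n => Num.sqrt (n%:R) / (m n)%:R) @ \oo --> (lambda : R) ->
    b @ \oo --> lambda * biasB F x.
  move=> ml.
  have cB : (fun n => (m n)%:R * (bernstein (m n) F x - F x)) @ \oo --> biasB F x.
    apply/cvgrPdist_le => e e0.
    have [M HM] := bernstein_voronovskaya xS F2 (cdf01 mX iidX) e0.
    have /cvgryPge /(_ M%:R) Hm := moo.
    near=> n; rewrite distrC; apply: HM.
    by rewrite -(ler_nat R); near: n.
  apply: (cvg_trans _ (cvgM ml cB)); apply: near_eq_cvg.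
  (* The factorisation cancels [m n], which is nonzero only from some [n] on. *)
  have /cvgryPge /(_ 1) Hm := moo.
  near=> n; have m1 : 1 <= (m n)%:R :> R by near: n.
  rewrite /b /=; field.
  by rewrite gt_eqF// (lt_le_trans ltr01 m1).
have law c l : c @ \oo --> l -> forall U : nat -> T -> R,
    (forall n w, U n w = W n w + V n w + c n) ->
    cvg_in_law P U (normal_prob l (Num.sqrt (sigma2 F x))).
  move=> cl U UE t _; rewrite normal_prob_shift ?gt_eqF//.
  apply: (cvg_trans _ (slut c l cl t)); apply: near_eq_cvg; apply: nearW => n /=.
  by congr (fine (P _)); apply/seteqP; split => w /=; rewrite UE.
split; last split.
- by apply: (law (fun=> 0)); [exact: cvg_cst|exact: YE].
- move=> /bcvg; rewrite mul0r => b0; exact: law b0 _ ZE.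
- by move=> lambda _ /bcvg bl; exact: law bl _ ZE.
Unshelve. all: by end_near. Qed.
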